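(* Let $\alpha\neq1$. Let $f\in S_\alpha$ and let $\xi\in C^\infty(M)$, $\xi\neq f$. Let $I\subset\mathbb R$ be an interval containing $0$, and suppose $\tau:I\to\mathbb R$ is such that $f+\tau(t)\xi>0$ on $M$ for all $t\in I$ and satisfies the ODE $$\ddot\tau(t)=2\,\frac{\int_M(f+\tau(t)\xi)^{\frac{1+\alpha}{1-\alpha}}\,\xi\,\lambda}{\int_M(f+\tau(t)\xi)^{\frac{2}{1-\alpha}}\,\lambda}\,\dot\tau(t)^2,\qquad \tau(0)=0,\qquad\dot\tau(0)=1.$$ Then $\gamma:I\to S_\alpha$ defined by $$\gamma(t)=\frac{2}{|1-\alpha|}\,\frac{f+\tau(t)\xi}{\left(\int_M(f+\tau(t)\xi)^{\frac{2}{1-\alpha}}\,\lambda\right)^{\frac{1-\alpha}{2}}}$$ is a geodesic of $\tilde\nabla^\alpha$ emanating from $\gamma(0)=f$. For $\xi\in T_fS_\alpha$, this is the unique geodesic with initial conditions $\gamma(0)=f$, $\dot\gamma(0)=\xi$. For $\bar f\in S_\alpha$ and $\xi=\bar f-f$, this is the unique geodesic from $f$ to $\bar f$ (that is, the solution $\tau$ on its maximal interval attains the value $1$ at some time $T>0$, so that $\gamma(T)=\bar f$, and up to affine reparametrization $\gamma|_{[0,T]}$ is the only geodesic of $\tilde\nabla^\alpha$ from $f$ to $\bar f$).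
   Context: $M$ is a closed, oriented, $n$-dimensional smooth manifold and $\lambda$ is a fixed smooth positive density ($n$-form) on $M$. For $\alpha\in\mathbb R$, $\alpha\neq1$, $$S_\alpha=\left\{f\in C^\infty(M): f>0,\ \int_M f^{\frac{2}{1-\alpha}}\,\lambda=\left(\frac{2}{|1-\alpha|}\right)^{\frac{2}{1-\alpha}}\right\},$$ a smooth submanifold of the Fr\'echet space $C^\infty(M)$ with tangent space $$T_fS_\alpha=\left\{\xi\in C^\infty(M):\int_M f^{\frac{1+\alpha}{1-\alpha}}\,\xi\,\lambda=0\right\}.$$ The radial projection $\pi^\alpha_f:T_fC^\infty(M)\to T_fS_\alpha$ is the projection with respect to the splitting $T_fC^\infty(M)=T_fS_\alpha\oplus\operatorname{span}\{f\}$, i.e. $$\pi^\alpha_f(\xi)=\xi-\left(\frac{|1-\alpha|}{2}\right)^{\frac{2}{1-\alpha}}\left(\int_M f^{\frac{1+\alpha}{1-\alpha}}\,\xi\,\lambda\right)f.$$ With $\nabla$ the trivial connection on $C^\infty(M)$, the connection $\tilde\nabla^\alpha$ on $S_\alpha$ is $(\tilde\nabla^\alpha_\xi\eta)_f=\pi^\alpha_f(\nabla_\xi\eta)$. A curve $\gamma$ in $S_\alpha$ is a geodesic of $\tilde\nabla^\alpha$ iff $\pi^\alpha_\gamma(\ddot\gamma)=0$, i.e. $\ddot\gamma(t)\in\operatorname{span}\{\gamma(t)\}$ for all $t$. *)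

(* Defs.v *)
(* MathComp-Analysis, with the real numbers an arbitrary R : realType. *)
From mathcomp Require Export all_boot all_order all_algebra.
From mathcomp Require Export all_classical all_reals all_analysis.
Export Order.TTheory GRing.Theory Num.Theory.
Export numFieldNormedType.Exports.

Set Implicit Arguments.
Unset Strict Implicit.
Unset Printing Implicit Defensive.

Local Open Scope classical_set_scope.
Local Open Scope ring_scope.

Section Euclidean.
Variable R : realType.

Definition pderivs n (s : seq 'I_n) (h : 'rV[R]_n -> R) : 'rV[R]_n -> R :=
  foldr (fun i g => 'D_(delta_mx 0 i) g) h s.

(* C^oo on V (meant for V open): all iterated partial derivatives exist and
   are continuous on V. *)
Definition smooth_on n (V : set 'rV[R]_n) (h : 'rV[R]_n -> R) : Prop :=
  forall (s : seq 'I_n) (x : 'rV[R]_n), V x ->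
    {for x, continuous (pderivs s h)} /\
    forall i : 'I_n, derivable (pderivs s h) x (delta_mx 0 i).

(* Iterated one-dimensional Lebesgue integrals; for nonnegative Borel g this is
   the integral of g for n-dimensional Lebesgue measure, by Tonelli. *)
Fixpoint lebesgue_int n : ('rV[R]_n -> \bar R) -> \bar R :=
  match n return ('rV[R]_n -> \bar R) -> \bar R with
  | 0 => fun g => g 0
  | m.+1 => fun g =>
      (\int[@lebesgue_measure R]_t
         lebesgue_int (fun y : 'rV[R]_m => g (row_mx t%:M y)))%E
  end.

End Euclidean.

(* [chart_inv] and [chart_map] are total functions; only their restrictions to
   [chart_im] and [chart_dom] are meaningful. *)
Record chart (R : realType) (n : nat) (T : topologicalType) := Chart {
  chart_dom : set T;
  chart_map : T -> 'rV[R]_n;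
  chart_inv : 'rV[R]_n -> T;
  chart_dom_open : open chart_dom;
  chart_im_open : open (chart_map @` chart_dom);
  chart_mapK : forall p, chart_dom p -> chart_inv (chart_map p) = p;
  chart_map_continuous : forall p, chart_dom p -> {for p, continuous chart_map};
  chart_inv_continuous : forall x, (chart_map @` chart_dom) x ->
    {for x, continuous chart_inv} }.

Definition chart_im R n T (c : @chart R n T) : set 'rV[R]_n :=
  chart_map c @` chart_dom c.

Definition transition R n T (c c' : @chart R n T) : 'rV[R]_n -> 'rV[R]_n :=
  chart_map c' \o chart_inv c.

(* The domain of [transition c c']. *)
Definition overlap R n T (c c' : @chart R n T) : set 'rV[R]_n :=
  chart_map c @` (chart_dom c `&` chart_dom c').

(* Closed oriented smooth n-manifolds, the orientation being given by an
   oriented smooth atlas.  Second countability follows from compactness. *)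
Record closedOrientedManifold (R : realType) (n : nat) := ClosedManifold {
  manifold_sort :> ptopologicalType;
  manifold_hausdorff : hausdorff_space manifold_sort;
  manifold_compact : compact [set: manifold_sort];
  atlas : set (chart R n manifold_sort);
  atlas_cover : forall p, exists2 c, atlas c & chart_dom c p;
  atlas_smooth : forall c c', atlas c -> atlas c' ->
    forall i : 'I_n, smooth_on (overlap c c') (fun x => transition c c' x 0 i);
  atlas_oriented : forall c c', atlas c -> atlas c' ->
    forall x, overlap c c' x -> 0 < \det ('J (transition c c') x) }.

Notation borel T := (g_sigma_algebraType (@open T)).

(* A smooth positive n-form [lambda], given by its local coefficients in
   [lambda = form_coef c dx_1 /\ ... /\ dx_n], together with the Borel measure
   [A |-> \int_A lambda] it induces; [form_measureE] determines the latter. *)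
Record positiveForm (R : realType) (n : nat) (M : closedOrientedManifold R n) :=
  PositiveForm {
  form_coef : chart R n M -> 'rV[R]_n -> R;
  form_coef_smooth : forall c, atlas c -> smooth_on (chart_im c) (form_coef c);
  form_coef_gt0 : forall c, atlas c ->
    forall x, chart_im c x -> 0 < form_coef c x;
  form_coef_transition : forall c c', atlas c -> atlas c' ->
    forall x, overlap c c' x ->
    form_coef c x =
      form_coef c' (transition c c' x) * \det ('J (transition c c') x);
  form_measure : {measure set (borel M) -> \bar R};
  form_measureE : forall c, atlas c ->
    forall A : set (borel M), measurable A -> A `<=` chart_dom c ->
    form_measure A =
      lebesgue_int
        (fun x => (form_coef c x * \1_(chart_map c @` A) x)%:E) }.

Section SmoothFunctions.
Variables (R : realType) (n : nat) (M : closedOrientedManifold R n).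

Definition smooth (f : M -> R) : Prop :=
  forall c : chart R n M, atlas c -> smooth_on (chart_im c) (f \o chart_inv c).

(* Convergence in the Frechet space C^oo(M): in every chart, uniform convergence
   on compact sets of all partial derivatives. *)
Definition smooth_cvg (F : set_system (M -> R)) (g : M -> R) : Prop :=
  forall c : chart R n M, atlas c ->
  forall (K : set 'rV[R]_n) (s : seq 'I_n) (e : R),
    compact K -> K `<=` chart_im c -> 0 < e ->
    \forall h \near F, forall x, K x ->
      `|pderivs s (h \o chart_inv c) x - pderivs s (g \o chart_inv c) x| < e.

(* Derivatives on an interval I are relative to I, hence one-sided at the
   endpoints that belong to I. *)
Definition punctured (I : set R) (t : R) : set_system R :=
  within [set u | I u /\ u != t] (nbhs t).

Definition has_velocity (I : set R) (gamma : R -> M -> R) (t : R)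
    (v : M -> R) : Prop :=
  smooth_cvg ((fun u => (u - t)^-1 *: (gamma u - gamma t)) @ punctured I t) v.

Definition has_derivative (I : set R) (gamma gamma' : R -> M -> R) : Prop :=
  forall t, I t -> smooth (gamma' t) /\ has_velocity I gamma t (gamma' t).

(* [G k] is the k-th derivative of [gamma] as a curve in C^oo(M). *)
Definition smooth_curve (I : set R) (gamma : R -> M -> R) : Prop :=
  (forall t, I t -> smooth (gamma t)) /\
  exists G : nat -> R -> M -> R,
    G 0%N = gamma /\ forall k, has_derivative I (G k) (G k.+1).

Definition real_derivative (I : set R) (tau tau' : R -> R) : Prop :=
  forall t, I t ->
    (fun u => (u - t)^-1 * (tau u - tau t)) @ punctured I t --> tau' t.

Definition nondegenerate_interval (I : set R) : Prop :=
  is_interval I /\ exists s t, [/\ I s, I t & s < t].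

End SmoothFunctions.

Section AlphaConnection.
Variables (R : realType) (n : nat) (M : closedOrientedManifold R n).
Variable lambda : positiveForm M.
Variable alpha : R.

Definition integralM (g : M -> R) : R :=
  \int[form_measure lambda]_(x in [set: borel M]) g x.

Definition S_alpha (f : M -> R) : Prop :=
  [/\ smooth f, forall x, 0 < f x &
      integralM (fun x => f x `^ (2 / (1 - alpha)))
        = (2 / `|1 - alpha|) `^ (2 / (1 - alpha))].

Definition TS_alpha (f xi : M -> R) : Prop :=
  smooth xi /\
  integralM (fun x => f x `^ ((1 + alpha) / (1 - alpha)) * xi x) = 0.

Definition radial_proj (f xi : M -> R) : M -> R :=
  xi - ((`|1 - alpha| / 2) `^ (2 / (1 - alpha))
        * integralM (fun x => f x `^ ((1 + alpha) / (1 - alpha)) * xi x)) *: f.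

Definition geodesic (I : set R) (gamma : R -> M -> R) : Prop :=
  [/\ smooth_curve I gamma,
      forall t, I t -> S_alpha (gamma t) &
      exists gamma1 gamma2 : R -> M -> R,
        [/\ has_derivative I gamma gamma1,
            has_derivative I gamma1 gamma2 &
            forall t, I t -> radial_proj (gamma t) (gamma2 t) = 0]].

Definition ode_rhs (f xi : M -> R) (tau tau1 : R) : R :=
  2 * (integralM (fun x =>
         (f x + tau * xi x) `^ ((1 + alpha) / (1 - alpha)) * xi x)
       / integralM (fun x => (f x + tau * xi x) `^ (2 / (1 - alpha))))
    * tau1 ^+ 2.

Definition ode_solution (f xi : M -> R) (I : set R) (tau : R -> R) : Prop :=
  [/\ nondegenerate_interval I, I 0,
      forall t, I t -> forall x, 0 < f x + tau t * xi x &
      exists tau1 tau2 : R -> R,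
        [/\ real_derivative I tau tau1, real_derivative I tau1 tau2,
            forall t, I t -> tau2 t = ode_rhs f xi (tau t) (tau1 t),
            tau 0 = 0 & tau1 0 = 1]].

(* Every solution is a restriction of [tau]. *)
Definition maximal_ode_solution (f xi : M -> R) (I : set R) (tau : R -> R) :
    Prop :=
  ode_solution f xi I tau /\
  forall (J : set R) (sigma : R -> R), ode_solution f xi J sigma ->
    J `<=` I /\ forall t, J t -> sigma t = tau t.

Definition normalized_line (f xi : M -> R) (tau : R -> R) (t : R) : M -> R :=
  (2 / `|1 - alpha|
   / integralM (fun x => (f x + tau t * xi x) `^ (2 / (1 - alpha)))
       `^ ((1 - alpha) / 2)) *: (f + tau t *: xi).

End AlphaConnection.

(* Main.v *)
Require Import Defs.
From mathcomp Require Import measurable_realfun ring lra.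

(** Write [p = 2 / (1 - alpha)] and [C = 2 / |1 - alpha|], so that [S_alpha] is
    the set of positive smooth functions with [\int f^p = C^p], the analogue
    of a sphere in [L^p], and [(1 + alpha) / (1 - alpha) = p - 1].  Along the line
    [s |-> f + s xi] put [F(s) = \int (f + s xi)^p] and [A(s) = C F(s)^(-1/p)],
    the factor that projects the line radially to the sphere ([amplitude]).
    Then [A' = - A q] with [q(s) = \int (f + s xi)^(p-1) xi / F(s)], and the
    differential equation of the theorem reads [tau'' = 2 q(tau) tau'^2].

    Existence.  The normalized line is [gamma = A(tau) (f + tau xi)].  The
    coefficients of its second derivative on [f] and [xi] are [A(tau)''] and
    [(tau A(tau))'' = tau A(tau)''], because the equation for [tau] is exactly
    [2 tau' A(tau)' + tau'' A(tau) = 0].  So [gamma''] is a multiple of [gamma]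
    ([normalized_line_geodesic]).

    Clock.  The same computation shows that [tau' A(tau)^2] is constant
    ([speed_amplitude]).  Let [H] be a primitive of [A^2] on the open interval
    of those [s] for which [f + s xi > 0].  A solution with [tau(0) = 0] and
    [tau'(0) = 1] satisfies [H(tau(t)) = t], and [H] is strictly increasing.
    Hence the maximal solution is the inverse of [H], defined on the range of
    [H] ([maximal_solution]); it reaches the value 1 at [T = H(1)] as soon as
    [f + xi > 0].

    Uniqueness.  If [delta] is a geodesic, then [delta'' = k(t) delta] with a
    scalar [k] that does not depend on the point of [M], so the Wronskian of
    the functions [t |-> delta(t)(x)] and [t |-> delta(t)(y)] is constant for
    all points [x], [y].  It follows that [delta] stays in a plane
    ([geodesic_planar]).  The initial position and velocity, or the two
    endpoints, then show that [delta] is a positive multiple of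
    [f + sigma(t) xi]; the multiple is [A(sigma)] since [delta] lies on the
    sphere, and the constant Wronskian gives [sigma' A(sigma)^2 = const].
    Therefore [H(sigma)] is affine in [t], and comparison with
    [H(tau(t)) = t] identifies [delta] with [gamma].

    Two points of analysis deserve mention.  The measure of [M] is positive and
    finite merely because the integral that defines the sphere is a nonzero
    real number ([borel_measure_fin]).  And [gamma] is a smooth curve in
    [C^oo(M)] because it is a combination of two fixed functions whose
    coefficients lie in a class of functions of [t] closed under
    differentiation ([line_function_derive]). *)

Set Implicit Arguments.
Unset Strict Implicit.
Unset Printing Implicit Defensive.

Local Open Scope classical_set_scope.
Local Open Scope ring_scope.

(** * Derivatives relative to an interval *)

Section RelativeDerivative.
Variable R : realType.
Implicit Types (I J : set R) (h k : R -> R) (t d e c : R).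

#[global] Instance punctured_filter I t : Filter (punctured I t).
Proof. exact: within_filter. Qed.

Definition derive_within I h t d :=
  (fun u => (u - t)^-1 * (h u - h t)) @ punctured I t --> d.

(** Caratheodory's form: a derivative is a continuous factor of the increment.
    It turns limits of difference quotients into algebra, and makes the sum,
    product and chain rules for one-sided derivatives immediate. *)
Lemma derive_withinP I h t d :
  derive_within I h t d <->
  exists2 g : R -> R, (forall z, h z - h t = (z - t) * g z) &
    g t = d /\ g @ within I (nbhs t) --> d.
Proof.
split=> [hd|[g hg [_ gd]]].
  exists (fun z => if z == t then d else (z - t)^-1 * (h z - h t)).
    move=> z; case: eqVneq => [->|zt]; first by rewrite !subrr mul0r.
    by rewrite mulrA divff ?mul1r // subr_eq0.
  rewrite eqxx; split => //.
  apply/cvgrPdist_lt => e e0.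
  move/cvgrPdist_lt : hd => /(_ e e0).
  rewrite /punctured !near_withinE; apply: filterS => z hz Iz.
  case: eqVneq => [_|zt]; first by rewrite subrr normr0.
  exact: hz.
apply: cvg_trans (cvg_trans _ gd).
  apply: near_eq_cvg; rewrite /punctured near_withinE; near=> z => -[Iz zt].
  by rewrite hg mulrA mulVf ?mul1r // subr_eq0.
by apply: cvg_app; rewrite /punctured; apply: within_subset => z [].
Unshelve. all: end_near. Qed.

Lemma derive_within_continuous I h t d :
  derive_within I h t d -> h @ within I (nbhs t) --> h t.
Proof.
move=> /derive_withinP[g hg [gt gd]].
have -> : h = fun z => h t + (z - t) * g z.
  by apply/funext => z; rewrite -hg addrC subrK.
rewrite subrr mul0r -[X in _ --> X]/(h t + 0).
apply: cvgD; first exact: cvg_cst.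
rewrite -(mul0r d); apply: cvgM => //.
rewrite -(subrr t); apply: cvgB; last exact: cvg_cst.
exact: cvg_within.
Qed.

Lemma derive_within_sub I J h t d :
  J `<=` I -> derive_within I h t d -> derive_within J h t d.
Proof.
move=> JI /derive_withinP[g hg [gt gd]]; apply/derive_withinP; exists g => //.
by split=> //; apply: cvg_trans gd; apply: cvg_app; apply: within_subset.
Qed.

(** Lets a computed derivative be replaced by an equal one after the rules of
    calculus have produced it. *)
Lemma derive_within_val I h t d e :
  derive_within I h t d -> d = e -> derive_within I h t e.
Proof. by move=> hd <-. Qed.

Lemma derive_within_cst I c t : derive_within I (fun=> c) t 0.
Proof.
apply/derive_withinP; exists (fun=> 0); last by split=> //; exact: cvg_cst.
by move=> z; rewrite subrr mulr0.
Qed.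

Lemma derive_within_id I t : derive_within I id t 1.
Proof.
apply/derive_withinP; exists (fun=> 1); last by split=> //; exact: cvg_cst.
by move=> z; rewrite mulr1.
Qed.

Lemma derive_withinD I h k t d e :
  derive_within I h t d -> derive_within I k t e ->
  derive_within I (fun u => h u + k u) t (d + e).
Proof.
move=> /derive_withinP[g hg [gt gd]] /derive_withinP[g' hg' [gt' gd']].
apply/derive_withinP; exists (fun u => g u + g' u).
  by move=> z; rewrite mulrDr -hg -hg' opprD addrACA.
by split; [rewrite gt gt'|exact: cvgD].
Qed.

Lemma derive_withinM I h k t d e :
  derive_within I h t d -> derive_within I k t e ->
  derive_within I (fun u => h u * k u) t (d * k t + h t * e).
Proof.
move=> hd; have hc := derive_within_continuous hd; move: hd.
move=> /derive_withinP[g hg [gt gd]] /derive_withinP[g' hg' [gt' gd']].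
apply/derive_withinP; exists (fun u => g u * k t + h u * g' u).
  move=> z; rewrite mulrDr mulrA -hg mulrCA -hg'; ring.
split; first by rewrite gt gt'.
by apply: cvgD; apply: cvgM => //; exact: cvg_cst.
Qed.

Lemma derive_withinZ I h t d c :
  derive_within I h t d -> derive_within I (fun u => c * h u) t (c * d).
Proof.
move=> hd; have := derive_withinM (derive_within_cst I c t) hd.
by rewrite mul0r add0r.
Qed.

Lemma derive_withinB I h k t d e :
  derive_within I h t d -> derive_within I k t e ->
  derive_within I (fun u => h u - k u) t (d - e).
Proof.
move=> hd /(derive_withinZ (c := -1)); rewrite mulN1r => ke.
by have := derive_withinD hd ke; under eq_fun do rewrite mulN1r.
Qed.

Lemma derive_within_comp I h k t d e :
  derive_within I h t d -> is_derive (h t) 1 k e ->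
  derive_within I (k \o h) t (e * d).
Proof.
move=> hd; have hc := derive_within_continuous hd; move: hd.
move=> /derive_withinP[g hg [gt gd]] /is_derive1_caratheodory[q [qE qc qt]].
apply/derive_withinP; exists (fun u => q (h u) * g u).
  by move=> z /=; rewrite qE hg; ring.
split; first by rewrite qt gt.
apply: cvgM => //; rewrite -qt.
by apply: (@cvg_comp _ _ _ h q _ (nbhs (h t))) => //; exact: qc.
Qed.

Lemma derive_withinV I h t d : h t != 0 -> derive_within I h t d ->
  derive_within I (fun u => (h u)^-1) t (- d / h t ^+ 2).
Proof.
move=> ht0 hd.
have iv : is_derive (h t) 1 (fun y : R => y^-1) (- (h t) ^- 2).
  split; first by apply: (@derivableV R _ id) => //; exact: derivable_id.
  by rewrite (@deriveV R _ id) ?derive_id ?scaler1 //; exact: derivable_id.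
apply: derive_within_val (derive_within_comp hd iv) _.
by rewrite mulrC mulNr mulrN.
Qed.

Lemma derive_within_div I h k t d e : k t != 0 ->
  derive_within I h t d -> derive_within I k t e ->
  derive_within I (fun u => h u / k u) t ((d * k t - h t * e) / k t ^+ 2).
Proof.
move=> kt0 hd ke.
apply: derive_within_val (derive_withinM hd (derive_withinV kt0 ke)) _.
by field.
Qed.

Lemma is_derive_within I h t d : is_derive t 1 h d -> derive_within I h t d.
Proof.
move=> hd; have := derive_within_comp (derive_within_id I t) (hd : is_derive (id t) 1 h d).
by rewrite mulr1.
Qed.

Lemma derive_within_is_derive I h t d :
  nbhs t I -> derive_within I h t d -> is_derive t 1 h d.
Proof.
move=> nI /derive_withinP[g hg [gt gd]].
apply/is_derive1_caratheodory; exists g; split=> //.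
  by move=> z; rewrite hg mulrC.
apply/cvgrPdist_lt => e e0; move/cvgrPdist_lt: gd => /(_ e e0).
rewrite near_withinE => wA; rewrite gt.
by apply: filterS2 wA nI => z /[apply].
Qed.

(** A point of a nondegenerate interval is never isolated in it, which is what
    makes relative derivatives unique. *)
Lemma punctured_proper I t :
  nondegenerate_interval I -> I t -> ProperFilter (punctured I t).
Proof.
move=> [itvI [a [b [Ia Ib ab]]]] It.
apply: Build_ProperFilter => -[e /= e0 he].
have [u [uI ut ue]] : exists u, [/\ I u, u != t & `|t - u| < e].
  have [tb|bt] := ltP t b.
    exists (Num.min b (t + e / 2)); split.
    - apply: (itvI _ _ It Ib); rewrite le_min ge_min lexx (ltW tb) /=.
      by rewrite andbT; lra.
    - by rewrite gt_eqF // lt_min tb /=; lra.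
    - have : Num.min b (t + e / 2) <= t + e / 2 by rewrite ge_min lexx orbT.
      have : t < Num.min b (t + e / 2) by rewrite lt_min tb /=; lra.
      by rewrite ltr_norml; set m := Num.min _ _; lra.
  have at' : a < t by lra.
  exists (Num.max a (t - e / 2)); split.
  - apply: (itvI _ _ Ia It); rewrite le_max ge_max lexx (ltW at') /=; lra.
  - by rewrite lt_eqF // gt_max at' /=; lra.
  - have : t - e / 2 <= Num.max a (t - e / 2) by rewrite le_max lexx orbT.
    have : Num.max a (t - e / 2) < t by rewrite gt_max at' /=; lra.
    by rewrite ltr_norml; set m := Num.max _ _; lra.
by apply: (he u).
Qed.

Lemma derive_within_unique I h t d e : nondegenerate_interval I -> I t ->
  derive_within I h t d -> derive_within I h t e -> d = e.
Proof.
move=> ndI It hd he; have PF := punctured_proper ndI It.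
exact: (cvg_unique _ hd he).
Qed.

(** One-sided derivatives at the endpoints only contribute continuity; between
    [s] and [t] the derivative is two-sided. *)
Lemma derive_within_MVT I h h' s t : is_interval I -> I s -> I t -> s < t ->
  (forall u, I u -> derive_within I h u (h' u)) ->
  exists2 c, I c & h t - h s = h' c * (t - s).
Proof.
move=> itvI Is It st hd.
have sI : `[s, t]%classic `<=` I.
  by move=> u /=; rewrite in_itv /=; exact: itvI.
have [u ust ->] : exists2 c, c \in `]s, t[%R & h t - h s = h' c * (t - s).
  apply: MVT => // [u ust|].
    apply: (@derive_within_is_derive `]s, t[).
      by apply: open_nbhs_nbhs; split => //; exact: itv_open.
    have ust' : u \in `[s, t]%R by apply: subset_itv_oo_cc.
    apply: derive_within_sub (hd _ (sI _ ust')).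
    by apply: subset_trans sI; exact: subset_itv_oo_cc.
  apply/subspace_continuousP => u ust.
  apply: derive_within_continuous.
  exact: derive_within_sub sI (hd _ (sI _ ust)).
by exists u => //; apply: sI; apply: subset_itv_oo_cc.
Qed.

Lemma derive_within_zero I h s t : is_interval I -> I s -> I t ->
  (forall u, I u -> derive_within I h u 0) -> h t = h s.
Proof.
move=> itvI; wlog st : s t / s <= t.
  move=> W Is It hd; have [/W->//|/ltW ts] := leP s t.
  by rewrite (W t s).
move: st; rewrite le_eqVlt => /predU1P[->//|st] Is It hd.
have [c _] := derive_within_MVT itvI Is It st hd.
by rewrite mul0r => /subr0_eq.
Qed.

Lemma derive_within_eq I h k h' t0 t : is_interval I -> I t0 -> I t ->
  (forall u, I u -> derive_within I h u (h' u)) ->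
  (forall u, I u -> derive_within I k u (h' u)) ->
  h t0 = k t0 -> h t = k t.
Proof.
move=> itvI It0 It hd kd e0; apply/subr0_eq.
have /= -> := @derive_within_zero I (fun u => h u - k u) _ _ itvI It0 It _.
  by rewrite e0 subrr.
by move=> u Iu; rewrite -(subrr (h' u)); apply: derive_withinB; auto.
Qed.

Lemma derive_within_gt0_lt I h h' s t : is_interval I -> I s -> I t -> s < t ->
  (forall u, I u -> derive_within I h u (h' u)) ->
  (forall u, I u -> 0 < h' u) -> h s < h t.
Proof.
move=> itvI Is It st hd h0.
have [c Ic e] := derive_within_MVT itvI Is It st hd.
by rewrite -subr_gt0 e mulr_gt0 ?h0 // subr_gt0.
Qed.

End RelativeDerivative.

(** * Curves in the space of smooth functions *)

Section SmoothOn.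
Variables (R : realType) (n : nat).
Implicit Types (V : set 'rV[R]_n) (h k : 'rV[R]_n -> R) (a b : R).

Lemma pderivs_lin V h k a b s x : open V -> smooth_on V h -> smooth_on V k ->
  V x -> pderivs s (fun y => a * h y + b * k y) x
         = a * pderivs s h x + b * pderivs s k x.
Proof.
move=> oV hs ks; elim: s x => [//|i s IHs] x Vx /=.
rewrite (@near_eq_derive _ _ _ _ (a \*: pderivs s h + b \*: pderivs s k)).
- have [_ /(_ i) dh] := hs s x Vx; have [_ /(_ i) dk] := ks s x Vx.
  rewrite deriveD; [|exact: derivableZ|exact: derivableZ].
  by rewrite (deriveZ _ dh) (deriveZ _ dk).
- by near=> y; rewrite IHs //; near: y; exact: open_nbhs_nbhs.
Unshelve. all: end_near. Qed.

Lemma smooth_on_lin V h k a b : open V -> smooth_on V h -> smooth_on V k ->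
  smooth_on V (fun y => a * h y + b * k y).
Proof.
move=> oV hs ks s x Vx.
have E : {near x, a \*: pderivs s h + b \*: pderivs s k =1
                  pderivs s (fun y => a * h y + b * k y)}.
  near=> y; rewrite (pderivs_lin _ _ _ oV hs ks) //.
  by near: y; exact: open_nbhs_nbhs.
have [ch dh] := hs s x Vx; have [ck dk] := ks s x Vx.
split.
  rewrite /prop_for /continuous_at (pderivs_lin a b s oV hs ks Vx).
  apply: cvg_trans (near_eq_cvg E) _.
  by apply: cvgD; apply: cvgM => //; exact: cvg_cst.
move=> i; apply: near_eq_derivable E _.
by apply: derivableD; apply: derivableZ.
Unshelve. all: end_near. Qed.

End SmoothOn.

Section SmoothFunctions.
Variables (R : realType) (n : nat) (M : closedOrientedManifold R n).
Implicit Types (f g v : M -> R) (gamma : R -> M -> R) (I : set R) (a b t : R).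

Lemma smooth_lin f g a b : smooth f -> smooth g -> smooth (a *: f + b *: g).
Proof.
move=> sf sg c ac.
exact: (smooth_on_lin a b (@chart_im_open _ _ _ c) (sf c ac) (sg c ac)).
Qed.

Lemma smooth_continuous f : smooth f -> continuous f.
Proof.
move=> sf p; have [c ac cp] := atlas_cover p.
have imp : chart_im c (chart_map c p) by exists p.
have [fc _] := sf c ac [::] _ imp.
rewrite /continuous_at -[in X in _ --> X](chart_mapK cp).
have E : {near p, (f \o chart_inv c) \o chart_map c =1 f}.
  near=> q; rewrite /= chart_mapK //.
  by near: q; apply: open_nbhs_nbhs; split => //; exact: chart_dom_open.
apply: cvg_trans (near_eq_cvg E) _.
apply: (@cvg_comp _ _ _ (chart_map c) (f \o chart_inv c)
          _ (nbhs (chart_map c p))) => //.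
exact: chart_map_continuous.
Unshelve. all: end_near. Qed.

(** A point of a chart is a compact set, so evaluation at a point is continuous
    on [C^oo(M)].  This is the only way velocities are used in the uniqueness
    part. *)
Lemma has_velocity_pointwise I gamma t v x :
  has_velocity I gamma t v ->
  derive_within I (fun u => gamma u x) t (v x).
Proof.
move=> hv; have [c ac cx] := atlas_cover x.
apply/cvgrPdist_lt => e e0.
have K1 : compact [set chart_map c x] by exact: compact_set1.
have K2 : [set chart_map c x] `<=` chart_im c by move=> _ ->; exists x.
have near_v := hv c ac _ [::] e K1 K2 e0.
near=> u.
have /(_ _ erefl) /= : forall y, [set chart_map c x] y ->
    `|((u - t)^-1 *: (gamma u - gamma t)) (chart_inv c y) - v (chart_inv c y)|
    < e by near: u; exact: near_v.
by rewrite (chart_mapK cx) distrC.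
Unshelve. all: end_near. Qed.

Lemma compact_bounded_pderivs f (c : chart R n M) K s : smooth f -> atlas c ->
  compact K -> K `<=` chart_im c ->
  exists2 B : R, 0 < B &
    forall x, K x -> `|pderivs s (f \o chart_inv c) x| <= B.
Proof.
move=> sf ac cK Kc; have [->|/set0P K0] := eqVneq K set0; first by exists 1.
have fK : {within K, continuous (fun x => `|pderivs s (f \o chart_inv c) x|)}.
  apply: continuous_in_subspaceT => x; rewrite inE => Kx.
  have [fc _] := sf c ac s x (Kc _ Kx).
  by apply: (@cvg_norm _ _ _ (nbhs x)); exact: fc.
have [z _ zmax] := compact_EVT_max K0 cK fK.
exists (1 + `|pderivs s (f \o chart_inv c) z|).
  by rewrite ltr_pwDl.
move=> x Kx; apply: le_trans (zmax x _) _; first by rewrite inE.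
by rewrite lerDr.
Qed.

(** In a fixed finite-dimensional subspace, convergence of the coefficients
    implies convergence in [C^oo(M)]: each partial derivative of [f] and [g] is
    bounded on a compact subset of a chart. *)
Lemma has_velocity_lin f g I (A B : R -> R) a b t : smooth f -> smooth g ->
  derive_within I A t a -> derive_within I B t b ->
  has_velocity I (fun u => A u *: f + B u *: g) t (a *: f + b *: g).
Proof.
move=> sf sg hA hB c ac K s e cK Kc e0.
have [Bf Bf0 hBf] := compact_bounded_pderivs s sf ac cK Kc.
have [Bg Bg0 hBg] := compact_bounded_pderivs s sg ac cK Kc.
have ef : 0 < e / 2 / Bf by rewrite !divr_gt0.
have eg : 0 < e / 2 / Bg by rewrite !divr_gt0.
move/cvgrPdist_lt : hA => /(_ _ ef) hA.
move/cvgrPdist_lt : hB => /(_ _ eg) hB.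
apply: filterS2 hA hB => u hA hB x Kx.
set qa := (u - t)^-1 * (A u - A t); set qb := (u - t)^-1 * (B u - B t).
have -> : (u - t)^-1 *: (A u *: f + B u *: g - (A t *: f + B t *: g))
        = qa *: f + qb *: g.
  by apply/funext => y; rewrite !fctE /qa /qb /GRing.scale /=; ring.
have L a' b' : pderivs s ((a' *: f + b' *: g) \o chart_inv c) x =
    a' * pderivs s (f \o chart_inv c) x + b' * pderivs s (g \o chart_inv c) x.
  exact: (pderivs_lin a' b' s (@chart_im_open _ _ _ c) (sf c ac) (sg c ac) (Kc _ Kx)).
rewrite !L.
move: (hBf _ Kx) (hBg _ Kx).
set Pf := pderivs _ _ _; set Pg := pderivs _ _ _ => hPf hPg.
have -> : qa * Pf + qb * Pg - (a * Pf + b * Pg) = (qa - a) * Pf + (qb - b) * Pg.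
  by ring.
apply: le_lt_trans (ler_normD _ _) _; rewrite !normrM.
rewrite [e]splitr; apply: ltrD.
  apply: le_lt_trans (ler_wpM2l _ hPf) _ => //.
  by rewrite -ltr_pdivlMr // distrC.
apply: le_lt_trans (ler_wpM2l _ hPg) _ => //.
by rewrite -ltr_pdivlMr // distrC.
Qed.

End SmoothFunctions.

(** * Integrals of continuous functions over a compact space *)

Section PowR.
Variable R : realType.
Implicit Types (a b y r : R).

(** A bound on [y^r] over [[a, b]] that holds whatever the sign of [r]. *)
Lemma powR_le_ends a b y r : 0 < a -> a <= y <= b -> y `^ r <= a `^ r + b `^ r.
Proof.
move=> a0 /andP[ay yb].
have y0 : 0 < y by exact: lt_le_trans ay.
have b0 : 0 < b by exact: lt_le_trans yb.
have [r0|r0] := leP 0 r.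
  rewrite -[leLHS]add0r lerD ?powR_ge0 //.
  by apply: ge0_ler_powR => //; rewrite nnegrE ltW.
rewrite -[leLHS]addr0 lerD ?powR_ge0 //.
rewrite -[r]opprK !(powRN _ (- r)) lef_pV2 ?posrE ?powR_gt0 //.
by apply: ge0_ler_powR => //; rewrite ?nnegrE ?oppr_ge0 ltW.
Qed.

Lemma continuous_powR y r : 0 < y -> {for y, continuous (fun z : R => z `^ r)}.
Proof.
move=> y0; apply: differentiable_continuous; apply/derivable1_diffP.
by have [] := is_derive1_powR r y0.
Qed.

End PowR.

Section CompactSpace.
Variables (R : realType) (T : ptopologicalType).
Hypothesis cT : compact [set: T].
Implicit Types (g f xi eta : T -> R).

Lemma continuous_borel_measurable g : continuous g ->
  measurable_fun [set: borel T] (g : borel T -> R).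
Proof.
move=> cg; apply: (measurability _ (RGenOpens.measurableE R)).
move=> _ [_ [a [b ->]] <-]; rewrite setTI; apply: sub_sigma_algebra.
by move/continuousP : cg; apply; exact: interval_open.
Qed.

Lemma continuous_min g : continuous g ->
  exists x0, forall x, g x0 <= g x.
Proof.
move=> cg.
have T0 : [set: T] !=set0 by exists point.
have [z _ zmin] := compact_EVT_min T0 cT (continuous_subspaceT cg).
by exists z => x; apply: zmin; rewrite inE.
Qed.

Lemma continuous_bound g : continuous g ->
  exists2 B : R, 0 < B & forall x, `|g x| <= B.
Proof.
move=> cg; have [|z zmin] := @continuous_min (fun x => - `|g x|).
  by move=> x; apply: cvgN; apply: (@cvg_norm _ _ _ (nbhs x)); exact: cg.
exists (1 + `|g z|); first by rewrite ltr_pwDl.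
by move=> x; have := zmin x; rewrite lerN2 => /le_trans; apply; rewrite lerDr.
Qed.

Lemma continuous_line f xi s : continuous f -> continuous xi ->
  continuous (fun x => f x + s * xi x).
Proof.
move=> cf cxi x; apply: cvgD; first exact: cf.
by apply: cvgM; [exact: cvg_cst|exact: cxi].
Qed.

Lemma continuous_powRf g q : continuous g ->
  (forall x, 0 < g x) -> continuous (fun x => g x `^ q).
Proof.
move=> cg g0 x.
apply: (@cvg_comp _ _ _ g (fun z => z `^ q) _ (nbhs (g x))); first exact: cg.
exact: continuous_powR.
Qed.

Lemma continuous_powRM g eta q : continuous g -> continuous eta ->
  (forall x, 0 < g x) -> continuous (fun x => g x `^ q * eta x).
Proof.
by move=> cg ce g0 x; apply: cvgM; [exact: continuous_powRf|exact: ce].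
Qed.

Variable mu : {measure set (borel T) -> \bar R}.
Hypothesis mu_fin : (mu [set: borel T] < +oo)%E.

Lemma continuous_integrable g : continuous g ->
  mu.-integrable [set: borel T] (EFin \o g).
Proof.
move=> cg; have [B B0 gB] := continuous_bound cg.
apply: measurable_bounded_integrable => //.
  exact: continuous_borel_measurable.
exists B; split; first exact: num_real.
by move=> y By x _; exact: le_trans (gB x) (ltW By).
Qed.


Lemma Rintegral_lin g (k : T -> R) (a b : R) : continuous g -> continuous k ->
  \int[mu]_(x in [set: borel T]) (a * g x + b * k x) =
  a * \int[mu]_(x in [set: borel T]) g x + b * \int[mu]_(x in [set: borel T]) k x.
Proof.
move=> cg ck.
have cZ (c : R) (h : T -> R) : continuous h -> continuous (fun x => c * h x).
  by move=> ch x; apply: cvgM; [exact: cvg_cst|exact: ch].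
rewrite RintegralD //; try by apply: continuous_integrable; exact: cZ.
by rewrite !RintegralZl //; exact: continuous_integrable.
Qed.

Lemma Rintegral_gt0 g : (0 < mu [set: borel T])%E -> continuous g ->
  (forall x, 0 < g x) -> 0 < \int[mu]_(x in [set: borel T]) g x.
Proof.
move=> mu0 cg g0; have [z zmin] := continuous_min cg.
apply: (@lt_le_trans _ _ (\int[mu]_(x in [set: borel T]) cst (g z) x)).
  by rewrite Rintegral_cst // mulr_gt0 // fine_gt0 // mu0.
apply: le_Rintegral => //; apply: continuous_integrable => //.
by move=> ?; exact: cvg_cst.
Qed.

(** Differentiation under the integral sign.  On a short interval around [s]
    the function [f + u xi] stays between two positive constants, so the
    derivative of the integrand is dominated by a constant. *)
Lemma is_derive_Rintegral_powR f xi eta q s :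
  continuous f -> continuous xi -> continuous eta ->
  (forall x, 0 < f x + s * xi x) ->
  is_derive s 1
    (fun u => \int[mu]_(x in [set: borel T]) ((f x + u * xi x) `^ q * eta x))
    (q * \int[mu]_(x in [set: borel T])
           ((f x + s * xi x) `^ (q - 1) * (xi x * eta x))).
Proof.
move=> cf cxi ceta pos.
have [z zmin] := continuous_min (continuous_line (s := s) cf cxi).
have [B B0 xiB] := continuous_bound cxi.
have [E E0 etaE] := continuous_bound ceta.
have [N N0 fN] := continuous_bound (continuous_line (s := s) cf cxi).
pose m := f z + s * xi z.
have m0 : 0 < m by exact: pos.
(* |u - s| < e keeps f + u xi above half of its minimum m at s. *)
pose e := m / 2 / B.
have e0 : 0 < e by rewrite !divr_gt0.
have near_s u x : u \in `]s - e, s + e[ -> m / 2 <= f x + u * xi x <= N + m / 2.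
  rewrite in_itv /= => su.
  have : `|(u - s) * xi x| <= m / 2.
    have -> : m / 2 = e * B by rewrite /e divfK ?gt_eqF.
    rewrite normrM ler_pM // ltW // ltr_norml; lra.
  have := zmin x; have := fN x; rewrite -/m !ler_norml; lra.
have pos_u u x : u \in `]s - e, s + e[ -> 0 < f x + u * xi x.
  by move=> us; have /andP[+ _] := near_s u x us; apply: lt_le_trans; lra.
pose F u x := (f x + u * xi x) `^ q * eta x.
have der u x : u \in `]s - e, s + e[ ->
    is_derive u 1 (F ^~ x) (q * (f x + u * xi x) `^ (q - 1) * (xi x * eta x)).
  move=> us; apply: (@derive_within_is_derive _ setT); first exact: filterT.
  have hlin := derive_withinD (derive_within_cst setT (f x) u)
                 (derive_withinM (derive_within_id setT u)
                    (derive_within_cst setT (xi x) u)).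
  have hp := derive_within_comp hlin (is_derive1_powR q (pos_u u x us)).
  apply: derive_within_val (derive_withinM hp (derive_within_cst setT _ u)) _.
  by rewrite /=; ring.
have sI : s \in `]s - e, s + e[ by rewrite in_itv /=; lra.
pose G (x : borel T) :=
  `|q| * ((m / 2) `^ (q - 1) + (N + m / 2) `^ (q - 1)) * (B * E).
have intF u : u \in `]s - e, s + e[ -> mu.-integrable setT (EFin \o F u).
  move=> us; apply: continuous_integrable; apply: continuous_powRM => //.
    exact: continuous_line.
  by move=> x; exact: pos_u.
have derF u x : u \in `]s - e, s + e[ -> setT x -> derivable (F ^~ x) u 1.
  by move=> us _; have [] := der u x us.
have G0 x : 0 <= G x.
  by rewrite /G !mulr_ge0 ?addr_ge0 ?powR_ge0 // ltW.
have intG : mu.-integrable setT (EFin \o G).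
  by apply: continuous_integrable => x; exact: cvg_cst.
have Gub u x : u \in `]s - e, s + e[ -> setT x -> `|partial1of2 F u x| <= G x.
  move=> us _; rewrite partial1of2E; have [_ ->] := der u x us.
  rewrite !normrM /G; apply: ler_pM => //; rewrite ?mulr_ge0 //.
    rewrite ler_wpM2l // ger0_norm ?powR_ge0 //.
    by apply: powR_le_ends; [rewrite divr_gt0|exact: near_s].
  by rewrite ler_pM.
split.
  exact: (derivable_under_integral measurableT sI intF derF G0 intG Gub).
rewrite -derive1E (differentiation_under_integral measurableT sI intF derF G0 intG Gub).
have ci : continuous (fun x => (f x + s * xi x) `^ (q - 1) * (xi x * eta x)).
  apply: continuous_powRM => //; first exact: continuous_line.
  by move=> x; apply: cvgM; [exact: cxi|exact: ceta].
rewrite -RintegralZl //; last exact: continuous_integrable.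
apply: eq_Rintegral => x _; rewrite partial1of2E mulrA.
by have [_ ->] := der s x sI.
Qed.

End CompactSpace.

(** A positive continuous [g] is bounded below by some [c > 0].  If the measure
    were infinite, the integral would be [+oo], whose real part is 0; if the
    measure were zero, the integral would be 0. *)
Lemma borel_measure_fin (R : realType) (T : ptopologicalType)
    (mu : {measure set (borel T) -> \bar R}) (g : T -> R) :
  compact [set: T] -> continuous g -> (forall x, 0 < g x) ->
  \int[mu]_(x in [set: borel T]) g x != 0 ->
  (0 < mu [set: borel T] < +oo)%E.
Proof.
move=> cT cg g0 I0; have [z zmin] := continuous_min cT cg.
apply/andP; split.
  rewrite lt0e measure_ge0 andbT; apply: contra I0 => /eqP mu0.
  rewrite /Rintegral null_set_integral //.
  by apply/measurable_EFinP; exact: continuous_borel_measurable.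
rewrite ltey; apply: contra I0 => /eqP muy.
rewrite /Rintegral (_ : integral _ _ _ = +oo)%E //.
apply/eqP; rewrite -leye_eq.
have <- : (\int[mu]_(x in [set: borel T]) (g z)%:E = +oo)%E.
  by rewrite integral_cst // muy gt0_muley ?lte_fin.
apply: ge0_le_integral => //.
- by move=> x _; rewrite lee_fin; exact: ltW.
- by apply/measurable_EFinP; exact: continuous_borel_measurable.
- by move=> x _; rewrite lee_fin.
Qed.

(** * Primitives on open intervals *)

Section Primitive.
Variable R : realType.
Implicit Types (U I : set R) (h H : R -> R).

Lemma is_interval_itvcc I s t : is_interval I -> I s -> I t -> `[s, t] `<=` I.
Proof. by move=> itvI Is It u /=; rewrite in_itv /=; exact: itvI. Qed.

Lemma open_both_sides U s : open U -> U s ->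
  exists e : R, [/\ 0 < e, U (s - e) & U (s + e)].
Proof.
move=> oU Us; have /nbhs_ballP[e /= e0 eU] : nbhs s U by exact: open_nbhs_nbhs.
by exists (e / 2); split; [lra|apply: eU..];
  rewrite /ball /= ltr_norml; lra.
Qed.

Lemma continuous_primitive_itv (h : R -> R) (c d : R) : c < 0 -> 0 < d ->
  {within `[c, d], continuous h} ->
  exists2 P, P 0 = 0 & forall s, c < s -> s < d ->
    {for s, continuous h} -> is_derive s 1 P (h s).
Proof.
move=> c0 d0 ch.
have hi : lebesgue_measure.-integrable `[c, d] (EFin \o h).
  by apply: continuous_compact_integrable => //; exact: segment_compact.
pose Q s : R := \int[lebesgue_measure]_(x in `[c, s]) h x.
exists (fun s => Q s - Q 0); first by rewrite subrr.
move=> s cs sd hs.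
have [dQ eQ] := continuous_FTC1_closed sd hi cs hs.
rewrite -[h s]subr0; apply: is_deriveB.
by split; [exact: dQ|rewrite -derive1E].
Qed.

(** The primitives vanishing at 0 on the compact subintervals around 0 agree
    where they are both defined, so they glue to a primitive on the whole
    interval. *)
Lemma continuous_primitive U h : open U -> is_interval U -> U 0 ->
  (forall s, U s -> {for s, continuous h}) ->
  exists2 H, H 0 = 0 & forall s, U s -> is_derive s 1 H (h s).
Proof.
move=> oU itvU U0 ch.
have P s : exists q : R * R * (R -> R), U s ->
    [/\ [/\ q.1.1 < 0, 0 < q.1.2, q.1.1 < s & s < q.1.2],
        `]q.1.1, q.1.2[ `<=` U, q.2 0 = 0 &
        forall u, u \in `]q.1.1, q.1.2[ -> is_derive u 1 q.2 (h u)].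
  have [Us|] := pselect (U s); last by exists (0, 0, id).
  have Umin : U (Num.min 0 s) by case: leP.
  have Umax : U (Num.max 0 s) by case: leP.
  have [e1 [e10 Uc _]] := open_both_sides oU Umin.
  have [e2 [e20 _ Ud]] := open_both_sides oU Umax.
  set c := Num.min 0 s - e1 in Uc; set d := Num.max 0 s + e2 in Ud.
  have c0 : c < 0 by rewrite /c; case: (leP 0 s) => ?; lra.
  have d0 : 0 < d by rewrite /d; case: (leP 0 s) => ?; lra.
  have cs : c < s by rewrite /c; case: (leP 0 s) => ?; lra.
  have sd : s < d by rewrite /d; case: (leP 0 s) => ?; lra.
  have cdU := is_interval_itvcc itvU Uc Ud.
  have [|Q Q0 dQ] := @continuous_primitive_itv h c d c0 d0.
    by apply: continuous_in_subspaceT => u; rewrite inE => /cdU; exact: ch.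
  exists (c, d, Q) => _ /=; split=> //.
    by apply: subset_trans cdU; exact: subset_itv_oo_cc.
  move=> u ucd; have ucd' := subset_itv_oo_cc ucd.
  move: ucd; rewrite in_itv /= => /andP[cu ud].
  by apply: dQ => //; apply: ch; exact: cdU.
have [q qP] := choice P.
exists (fun s => (q s).2 s); first by have [] := qP 0 U0.
move=> s Us; have [[q1 q2 q3 q4] qU q0 qd] := qP s Us.
apply: (near_eq_is_derive _ (qd s _)); last by rewrite in_itv /= q3 q4.
near=> u.
have us : u \in `](q s).1.1, (q s).1.2[.
  by near: u; apply: near_in_itvoo; rewrite in_itv /= q3 q4.
have [[r1 r2 r3 r4] rU r0 rd] := qP u (qU _ us).
pose I : set R := `](q s).1.1, (q s).1.2[ `&` `](q u).1.1, (q u).1.2[.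
apply: (@derive_within_eq _ I _ _ h 0).
- move=> a b [Ia Ib] [Ia' Ib'] x axb; split.
    exact: (@interval_is_interval _ _ a b).
  exact: (@interval_is_interval _ _ a b).
- by split; rewrite /= in_itv /= ?q1 ?q2 ?r1 ?r2.
- by split=> //=; rewrite in_itv /= r3 r4.
- by move=> x [xs xu]; apply: is_derive_within; exact: qd.
- by move=> x [xs xu]; apply: is_derive_within; exact: rd.
- by rewrite q0 r0.
Unshelve. all: end_near. Qed.

End Primitive.

(** * The sphere along an affine line *)

Section Sphere.
Variables (R : realType) (n : nat) (M : closedOrientedManifold R n).
Variables (lambda : positiveForm M) (alpha : R).
Hypothesis alpha1 : alpha != 1.
Implicit Types (f g w xi eta : M -> R) (s a q : R).

Local Notation p := (2 / (1 - alpha)).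
Local Notation C := (2 / `|1 - alpha|).

Lemma exponent_pred : (1 + alpha) / (1 - alpha) = p - 1.
Proof. by field; rewrite subr_eq0 eq_sym. Qed.

Lemma exponent_neq0 : p != 0.
Proof. by rewrite mulf_neq0 // invr_eq0 subr_eq0 eq_sym. Qed.

Lemma exponent_inv : (1 - alpha) / 2 = p^-1.
Proof. by rewrite invf_div. Qed.

Lemma radius_gt0 : 0 < C.
Proof. by rewrite divr_gt0 // normr_gt0 subr_eq0 eq_sym. Qed.

Lemma S_alpha_measure f : S_alpha lambda alpha f ->
  (0 < form_measure lambda [set: borel M] < +oo)%E.
Proof.
move=> [sf f0 If].
apply: (@borel_measure_fin R M (form_measure lambda) (fun x => f x `^ p)).
- exact: manifold_compact.
- by apply: continuous_powRf => //; exact: smooth_continuous.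
- by move=> x; exact: powR_gt0.
- by move: If; rewrite /integralM => ->; rewrite gt_eqF ?powR_gt0 ?radius_gt0.
Qed.

Lemma S_alpha_integrable f g : S_alpha lambda alpha f -> continuous g ->
  (form_measure lambda).-integrable [set: borel M] (EFin \o g).
Proof.
move=> /S_alpha_measure/andP[_ mfin].
by apply: continuous_integrable => //; exact: manifold_compact.
Qed.

Lemma integral_radial f a : S_alpha lambda alpha f ->
  integralM lambda (fun x => f x `^ (p - 1) * (a * f x)) = a * C `^ p.
Proof.
move=> Sf; have [sf f0 If] := Sf; rewrite -If /integralM -RintegralZl //.
  apply: eq_Rintegral => x _; rewrite mulrCA; congr (_ * _).
  rewrite -[X in _ * X](powRr1 (ltW (f0 x))) -powRD ?subrK //.
  by rewrite (gt_eqF (f0 x)) implybT.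
apply: (S_alpha_integrable Sf); apply: continuous_powRf => //.
exact: smooth_continuous.
Qed.

(** The coefficient in [radial_proj] is normalized so that multiples of [f] are
    killed: [C^(-p) \int f^(p-1) (a f) = a] on the sphere. *)
Lemma radial_proj_scale f a :
  S_alpha lambda alpha f -> radial_proj lambda alpha f (a *: f) = 0.
Proof.
move=> Sf; have C0 := radius_gt0.
rewrite /radial_proj exponent_pred.
have -> : (fun x => f x `^ (p - 1) * (a *: f) x)
        = (fun x => f x `^ (p - 1) * (a * f x)) by [].
rewrite (integral_radial _ Sf).
have -> : (`|1 - alpha| / 2) `^ p * (a * C `^ p) = a.
  rewrite mulrCA -powRM ?divr_ge0 //.
  rewrite (_ : _ / 2 * _ = 1) ?powR1 ?mulr1 //.
  by field; rewrite normr_eq0 subr_eq0 eq_sym.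
by rewrite subrr.
Qed.

Lemma radial_proj_eq0 f w :
  radial_proj lambda alpha f w = 0 -> exists k, w = k *: f.
Proof. by move/subr0_eq => e; eexists; exact: e. Qed.

Section Line.
Variables f xi : M -> R.
Hypotheses (Sf : S_alpha lambda alpha f) (sxi : smooth xi).

Let cf : continuous f.
Proof. by have [? _ _] := Sf; exact: smooth_continuous. Qed.

Let cxi : continuous xi.
Proof. exact: smooth_continuous. Qed.

Definition admissible : set R := [set s | forall x, 0 < f x + s * xi x].

(** These integrals are stable under differentiation in [s]. *)
Definition moment q eta s : R :=
  integralM lambda (fun x => (f x + s * xi x) `^ q * eta x).

(** The integral to be normalized to [C^p]. *)
Definition total s : R := integralM lambda (fun x => (f x + s * xi x) `^ p).

(** The factor that brings [f + s xi] to the sphere. *)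
Definition amplitude s : R := C * total s `^ (- p^-1).

(** The logarithmic derivative of [total], divided by [p]; it is also minus the
    logarithmic derivative of [amplitude]. *)
Definition log_slope s : R := moment (p - 1) xi s / total s.

Lemma admissible0 : admissible 0.
Proof. by have [_ f0 _] := Sf; move=> x; rewrite mul0r addr0. Qed.

Lemma admissible_interval : is_interval admissible.
Proof.
move=> a b Ia Ib s /andP[as_ sb] x; have := Ia x; have := Ib x.
have [xi0|xi0] := leP 0 (xi x).
  move=> _ /lt_le_trans; apply; rewrite lerD2l; exact: ler_wpM2r.
move=> + _ => /lt_le_trans; apply; rewrite lerD2l.
by apply: ler_wnM2r => //; exact: ltW.
Qed.

(** By compactness of [M], [f + s xi] has a positive minimum and [xi] is
    bounded. *)
Lemma admissible_open : open admissible.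
Proof.
rewrite openE => s As.
have [z zmin] := continuous_min (@manifold_compact _ _ M)
  (continuous_line (s := s) cf cxi).
have [B B0 xiB] := continuous_bound (@manifold_compact _ _ M) cxi.
apply/nbhs_ballP; exists ((f z + s * xi z) / B) => /=; first by rewrite divr_gt0.
move=> u; rewrite /ball /= => su x.
have zx := zmin x.
have : `|(s - u) * xi x| < f z + s * xi z.
  rewrite normrM (le_lt_trans (ler_wpM2l _ (xiB x))) //.
  by rewrite -ltr_pdivlMr.
by rewrite ltr_norml => /andP[_]; lra.
Qed.

Lemma total_gt0 s : admissible s -> 0 < total s.
Proof.
move=> As; have /andP[mu0 mufin] := S_alpha_measure Sf.
apply: Rintegral_gt0 => //; first exact: manifold_compact.
  by apply: continuous_powRf => //; exact: continuous_line.
by move=> x; exact: powR_gt0.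
Qed.

Lemma is_derive_moment q eta s : continuous eta -> admissible s ->
  is_derive s 1 (moment q eta) (q * moment (q - 1) (fun x => xi x * eta x) s).
Proof.
move=> ceta As; have /andP[_ mufin] := S_alpha_measure Sf.
by apply: is_derive_Rintegral_powR => //; exact: manifold_compact.
Qed.

Lemma total_moment : total = moment p (fun=> 1).
Proof.
by apply/funext => s; apply: eq_Rintegral => x _; rewrite mulr1.
Qed.

Lemma is_derive_total s : admissible s ->
  is_derive s 1 total (p * moment (p - 1) xi s).
Proof.
move=> As; rewrite total_moment.
have -> : moment (p - 1) xi s = moment (p - 1) (fun x => xi x * 1) s.
  by congr moment; apply/funext => x; rewrite mulr1.
by apply: is_derive_moment => // x; exact: cvg_cst.
Qed.

Lemma amplitude_gt0 s : admissible s -> 0 < amplitude s.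
Proof. by move=> As; rewrite mulr_gt0 ?radius_gt0 // powR_gt0 // total_gt0. Qed.

Lemma is_derive_amplitude s : admissible s ->
  is_derive s 1 amplitude (- (amplitude s * log_slope s)).
Proof.
move=> As; apply: (@derive_within_is_derive _ setT); first exact: filterT.
have t0 := total_gt0 As.
have dt := is_derive_within setT (is_derive_total As).
have dp := derive_within_comp dt (is_derive1_powR (- p^-1) t0).
apply: derive_within_val (derive_withinZ (c := C) dp) _.
rewrite /amplitude /log_slope powRD ?(gt_eqF t0) ?implybT // powR_inv1 ?ltW //.
have := exponent_neq0; set P := 2 / (1 - alpha) => P0.
by field; rewrite P0 normr_eq0 subr_eq0 (eq_sym 1) alpha1 (gt_eqF t0).
Qed.

Lemma normalized_lineE tau t :
  normalized_line lambda alpha f xi tau t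
  = amplitude (tau t) *: (f + tau t *: xi).
Proof. by rewrite /normalized_line /amplitude powRN exponent_inv. Qed.

Lemma integral_scaled a s : 0 <= a -> admissible s ->
  integralM lambda (fun x => (a * (f x + s * xi x)) `^ p) = a `^ p * total s.
Proof.
move=> a0 As; rewrite /total /integralM -RintegralZl //.
  by apply: eq_Rintegral => x _; rewrite powRM // ltW.
apply: (S_alpha_integrable Sf); apply: continuous_powRf => //.
exact: continuous_line.
Qed.

Lemma S_alpha_amplitude s : admissible s ->
  S_alpha lambda alpha (amplitude s *: (f + s *: xi)).
Proof.
move=> As; have [sf f0 If] := Sf; have a0 := amplitude_gt0 As; split.
- rewrite scalerDr scalerA; exact: smooth_lin.
- by move=> x; exact: mulr_gt0 a0 (As x).
- have -> : (fun x => ((amplitude s *: (f + s *: xi)) x) `^ p)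
          = (fun x => (amplitude s * (f x + s * xi x)) `^ p) by [].
  rewrite integral_scaled // ?ltW // /amplitude powRM ?powR_ge0 ?ltW ?radius_gt0 //.
  rewrite -powRrM mulNr mulVf ?exponent_neq0 // powR_inv1 ?ltW ?total_gt0 //.
  by rewrite divfK // gt_eqF ?total_gt0.
Qed.

(** A ray meets the sphere only once. *)
Lemma amplitude_unique a s : 0 < a -> admissible s ->
  S_alpha lambda alpha (a *: (f + s *: xi)) -> a = amplitude s.
Proof.
move=> a0 As [_ _].
have -> : (fun x => ((a *: (f + s *: xi)) x) `^ p)
          = (fun x => (a * (f x + s * xi x)) `^ p) by [].
rewrite integral_scaled ?ltW // => e.
have := congr1 (fun z => z `^ p^-1) e.
rewrite powRM ?powR_ge0 ?ltW ?total_gt0 //.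
rewrite -!powRrM divff ?exponent_neq0 // !powRr1 ?ltW ?radius_gt0 //.
by rewrite /amplitude powRN => <-; rewrite mulfK // gt_eqF // powR_gt0 // total_gt0.
Qed.

Lemma amplitude0 : amplitude 0 = 1.
Proof.
apply/esym/amplitude_unique; [exact: ltr01|exact: admissible0|].
by rewrite scale0r addr0 scale1r.
Qed.

End Line.
End Sphere.

(** * Normalized lines are geodesics *)

Section SmoothPlanarCurves.
Variables (R : realType) (n : nat) (M : closedOrientedManifold R n).
Variables (f g : M -> R) (I : set R).
Hypotheses (sf : smooth f) (sg : smooth g).

Lemma has_derivative_lin (A B A' B' : R -> R) :
  (forall t, I t -> derive_within I A t (A' t)) ->
  (forall t, I t -> derive_within I B t (B' t)) ->
  has_derivative I (fun t => A t *: f + B t *: g)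
                   (fun t => A' t *: f + B' t *: g).
Proof.
move=> dA dB t It; split; first exact: smooth_lin.
by apply: has_velocity_lin; auto.
Qed.

(** Closure under differentiation provides all the derivatives of the
    coefficients at once, by iterating a choice of derivative. *)
Lemma smooth_curve_lin (K : set (R -> R)) (A B : R -> R) :
  (forall h, K h -> exists2 h', K h' &
     forall t, I t -> derive_within I h t (h' t)) ->
  K A -> K B -> smooth_curve I (fun t => A t *: f + B t *: g).
Proof.
move=> dK KA KB; split; first by move=> t _; exact: smooth_lin.
have : forall h : {h | K h}, exists h' : {h | K h},
    forall t, I t -> derive_within I (sval h) t (sval h' t).
  by move=> [h Kh]; have [h' Kh' dh] := dK h Kh; exists (exist _ h' Kh').
move=> /choice[D DP].
exists (fun k t => sval (iter k D (exist _ A KA)) t *: f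
                 + sval (iter k D (exist _ B KB)) t *: g).
split; first by [].
by move=> k; apply: has_derivative_lin => t It; exact: DP.
Qed.

End SmoothPlanarCurves.

Section Solutions.
Variables (R : realType) (n : nat) (M : closedOrientedManifold R n).
Variables (lambda : positiveForm M) (alpha : R).
Hypothesis alpha1 : alpha != 1.
Variables f xi : M -> R.
Hypotheses (Sf : S_alpha lambda alpha f) (sxi : smooth xi).
Implicit Types (I J : set R) (tau : R -> R).

Local Notation total := (total lambda alpha f xi).
Local Notation moment := (moment lambda f xi).
Local Notation amplitude := (amplitude lambda alpha f xi).
Local Notation log_slope := (log_slope lambda alpha f xi).
Local Notation admissible := (admissible f xi).
Local Notation p := (2 / (1 - alpha)).
Local Notation C := (2 / `|1 - alpha|).

(** Functions of time built from a solution [tau] and its velocity [tau1]; the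
    generators are the ones that appear when [amplitude (tau t)] is
    differentiated repeatedly. *)
Inductive line_function (tau tau1 : R -> R) : (R -> R) -> Prop :=
| LineConst c : line_function tau tau1 (fun=> c)
| LineTime : line_function tau tau1 tau
| LineSpeed : line_function tau tau1 tau1
| LineMoment q eta : continuous eta ->
    line_function tau tau1 (fun t => moment q eta (tau t))
| LineTotal r : line_function tau tau1 (fun t => total (tau t) `^ r)
| LineAdd h k : line_function tau tau1 h -> line_function tau tau1 k ->
    line_function tau tau1 (fun t => h t + k t)
| LineMul h k : line_function tau tau1 h -> line_function tau tau1 k ->
    line_function tau tau1 (fun t => h t * k t).

Lemma ode_rhsE s v : ode_rhs lambda alpha f xi s v = 2 * log_slope s * v ^+ 2.
Proof. by rewrite /ode_rhs exponent_pred. Qed.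

Lemma ode_solution_sub I J tau : ode_solution lambda alpha f xi I tau ->
  J `<=` I -> nondegenerate_interval J -> J 0 ->
  ode_solution lambda alpha f xi J tau.
Proof.
move=> [_ _ pos [t1 [t2 [d1 d2 e t0 t10]]]] JI ndJ J0; split=> //.
  by move=> t /JI; exact: pos.
exists t1, t2; split=> //.
- by move=> t Jt; apply: derive_within_sub JI (d1 t (JI _ Jt)).
- by move=> t Jt; apply: derive_within_sub JI (d2 t (JI _ Jt)).
- by move=> t /JI; exact: e.
Qed.

Section OneSolution.
Variables (I : set R) (tau tau1 tau2 : R -> R).
Hypothesis adm : forall t, I t -> admissible (tau t).
Hypothesis d1 : forall t, I t -> derive_within I tau t (tau1 t).
Hypothesis d2 : forall t, I t -> derive_within I tau1 t (tau2 t).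
Hypothesis ode : forall t, I t -> tau2 t = ode_rhs lambda alpha f xi (tau t) (tau1 t).

(** The equation for [tau] is what keeps the class closed: it expresses the
    derivative of [tau1] through [tau] and [tau1]. *)
Lemma line_function_derive h : line_function tau tau1 h ->
  exists2 h', line_function tau tau1 h' &
    forall t, I t -> derive_within I h t (h' t).
Proof.
have LT := LineTime; have LS := LineSpeed; have LC := LineConst.
elim=> {h} [c||| q eta ceta | r | h k _ [h' Lh' dh] _ [k' Lk' dk]
           | h k Lh [h' Lh' dh] Lk [k' Lk' dk]].
- by exists (fun=> 0) => // t _; exact: derive_within_cst.
- by exists tau1.
- pose L t := 2 * (moment (p - 1) xi (tau t) * total (tau t) `^ (-1)) * (tau1 t * tau1 t).
  exists L.
    apply: LineMul; last exact: LineMul.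
    apply: LineMul; first exact: LC.
    apply: LineMul; last exact: LineTotal.
    by apply: LineMoment; exact: smooth_continuous.
  move=> t It; apply: derive_within_val (d2 It) _.
  rewrite ode // ode_rhsE /L /log_slope powR_inv1 ?expr2 //.
  exact/ltW/(total_gt0 alpha1 Sf sxi (adm It)).
- exists (fun t => q * moment (q - 1) (fun x => xi x * eta x) (tau t) * tau1 t).
    apply: LineMul => //; apply: LineMul => //; apply: LineMoment => x.
    by apply: cvgM; [exact: smooth_continuous|exact: ceta].
  move=> t It; apply: derive_within_comp (d1 It) _.
  exact: (is_derive_moment alpha1 Sf sxi q ceta (adm It)).
- exists (fun t => r * total (tau t) `^ (r - 1)
                  * (p * moment (p - 1) xi (tau t)) * tau1 t).
    apply: LineMul => //; apply: LineMul; first by apply: LineMul => //; exact: LineTotal.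
    by apply: LineMul => //; apply: LineMoment; exact: smooth_continuous.
  move=> t It.
  have dt := derive_within_comp (d1 It) (is_derive_total alpha1 Sf sxi (adm It)).
  have t0 := total_gt0 alpha1 Sf sxi (adm It).
  have := derive_within_comp dt (is_derive1_powR r t0).
  by move=> /derive_within_val; apply; rewrite /= !mulrA.
- exists (fun t => h' t + k' t); first exact: LineAdd.
  by move=> t It; apply: derive_withinD; auto.
- exists (fun t => h' t * k t + h t * k' t); first by apply: LineAdd; apply: LineMul.
  by move=> t It; apply: derive_withinM; auto.
Qed.

Let a t := amplitude (tau t).
Let a1 t := - (a t * log_slope (tau t)) * tau1 t.

Lemma derive_within_amplitude t : I t -> derive_within I a t (a1 t).
Proof.
move=> It; apply: derive_within_comp (d1 It) _.
exact: (is_derive_amplitude alpha1 Sf sxi (adm It)).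
Qed.

Lemma line_function_amplitude : line_function tau tau1 a.
Proof. by apply: LineMul; [exact: LineConst|exact: LineTotal]. Qed.

Lemma line_function_amplitude1 : exists2 h, line_function tau tau1 h &
  forall t, I t -> a1 t = h t.
Proof.
exists (fun t => -1 * (a t * (moment (p - 1) xi (tau t) * total (tau t) `^ (-1)))
                 * tau1 t).
  apply: LineMul; last exact: LineSpeed.
  apply: LineMul; first exact: LineConst.
  apply: LineMul; first exact: line_function_amplitude.
  apply: LineMul; last exact: LineTotal.
  by apply: LineMoment; exact: smooth_continuous.
move=> t It; rewrite /a1 /log_slope powR_inv1 ?mulN1r //.
exact/ltW/(total_gt0 alpha1 Sf sxi (adm It)).
Qed.

Lemma normalized_line_geodesic :
  geodesic lambda alpha I (normalized_line lambda alpha f xi tau).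
Proof.
have gE : normalized_line lambda alpha f xi tau
        = fun t => a t *: f + (tau t * a t) *: xi.
  apply/funext => t; rewrite normalized_lineE scalerDr scalerA.
  by rewrite [tau t * _]mulrC.
have [sf _ _] := Sf.
have La := line_function_amplitude.
have Lta : line_function tau tau1 (fun t => tau t * a t).
  by apply: LineMul => //; exact: LineTime.
split.
- by rewrite gE; apply: smooth_curve_lin line_function_derive La Lta.
- by move=> t It; rewrite normalized_lineE; exact: (S_alpha_amplitude alpha1 Sf sxi (adm It)).
have [h1 Lh1 h1E] := line_function_amplitude1.
have [h2 _ dh1] := line_function_derive Lh1.
have da t : I t -> derive_within I a t (h1 t).
  by move=> It; rewrite -h1E //; exact: derive_within_amplitude.
pose b1 t := tau1 t * a t + tau t * h1 t.
exists (fun t => h1 t *: f + b1 t *: xi).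
(* The coefficient of xi is tau h2 because 2 tau1 h1 + tau2 a = 0. *)
exists (fun t => h2 t *: f + (tau t * h2 t) *: xi); split.
- by rewrite gE; apply: has_derivative_lin => // t It; apply: derive_withinM; auto.
- apply: has_derivative_lin => // t It.
  have := derive_withinD (derive_withinM (d2 It) (da t It)) (derive_withinM (d1 It) (dh1 t It)).
  move=> /derive_within_val; apply.
  rewrite ode // ode_rhsE -h1E // /a1; ring.
move=> t It.
have a0 : 0 < a t := amplitude_gt0 alpha1 Sf sxi (adm It).
have -> : h2 t *: f + (tau t * h2 t) *: xi
        = (h2 t / a t) *: normalized_line lambda alpha f xi tau t.
  rewrite normalized_lineE scalerA divfK ?gt_eqF //.
  by rewrite scalerDr scalerA [tau t * _]mulrC.
apply: (radial_proj_scale alpha1); rewrite normalized_lineE.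
by exact: (S_alpha_amplitude alpha1 Sf sxi (adm It)).
Qed.

(** First integral of the equation: with [a = amplitude (tau t)] one has
    [a' = - a q tau1] and [tau2 = 2 q tau1^2], where [q] is [log_slope]. *)
Lemma speed_amplitude t0 t : is_interval I -> I t0 -> I t ->
  tau1 t * a t ^+ 2 = tau1 t0 * a t0 ^+ 2.
Proof.
move=> itvI It0 It.
apply: (@derive_within_zero _ I (fun t => tau1 t * a t ^+ 2) _ _ itvI It0 It).
move=> u Iu.
have da := derive_within_amplitude Iu.
have := derive_withinM (d2 Iu) (derive_withinM da da).
by move=> /derive_within_val; apply; rewrite ode // ode_rhsE /a1; ring.
Qed.

End OneSolution.

End Solutions.

(** * Geodesics are planar; the clock of a line *)

Section Planarity.
Variables (R : realType) (n : nat) (M : closedOrientedManifold R n).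
Variables (lambda : positiveForm M) (alpha : R).
Hypothesis alpha1 : alpha != 1.

Lemma S_alpha_scale f a : S_alpha lambda alpha f -> 0 < a ->
  S_alpha lambda alpha (a *: f) -> a = 1.
Proof.
move=> Sf a0 Saf; have [sf _ _] := Sf.
rewrite -(amplitude0 alpha1 Sf sf).
apply: (amplitude_unique alpha1 Sf sf a0); first exact: admissible0 Sf.
by rewrite scale0r addr0.
Qed.

(** Fix a reference point [x0].  The Wronskians [W y] of [delta t x0] and
    [delta t y] are constant because [delta''] is a multiple of [delta] by a
    scalar independent of the point.  So all the ratios
    [delta t y / delta t x0] have derivatives proportional to one another,
    namely [W y / (delta t x0)^2], and [theta] is a common primitive of
    [1 / (delta t x0)^2]. *)
Lemma geodesic_planar J delta t0 x0 : nondegenerate_interval J -> J t0 ->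
  geodesic lambda alpha J delta ->
  exists v : M -> R, exists theta : R -> R,
  [/\ forall y, derive_within J (fun t => delta t y) t0 (v y), theta t0 = 0,
      forall t, J t -> derive_within J theta t ((delta t x0 ^+ 2)^-1) &
      forall t y, J t -> delta t y = delta t x0 * (delta t0 y / delta t0 x0
         + theta t * (delta t0 x0 * v y - v x0 * delta t0 y))].
Proof.
move=> [itvJ _] Jt0 [_ SJ [d1 [d2 [hd1 hd2 rad]]]].
have D1 t y : J t -> derive_within J (fun u => delta u y) t (d1 t y).
  by move=> Jt; apply: has_velocity_pointwise; have [] := hd1 t Jt.
have D2 t y : J t -> derive_within J (fun u => d1 u y) t (d2 t y).
  by move=> Jt; apply: has_velocity_pointwise; have [] := hd2 t Jt.
have pos t y : J t -> 0 < delta t y by move=> /SJ[_ + _]; apply.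
pose W y t := delta t x0 * d1 t y - d1 t x0 * delta t y.
have WE y t : J t -> W y t = W y t0.
  move=> Jt; apply: (@derive_within_zero _ J (W y) t0 t itvJ Jt0 Jt) => u Ju.
  have [k kE] := radial_proj_eq0 (rad u Ju).
  apply: derive_within_val (derive_withinB
    (derive_withinM (D1 u x0 Ju) (D2 u y Ju))
    (derive_withinM (D2 u x0 Ju) (D1 u y Ju))) _.
  by rewrite kE !fctE /GRing.scale /=; ring.
pose r y t := delta t y / delta t x0.
have dr y t : J t -> derive_within J (r y) t (W y t0 * (delta t x0 ^+ 2)^-1).
  move=> Jt; have x0n0 : delta t x0 != 0 by rewrite gt_eqF ?pos.
  apply: derive_within_val (derive_within_div x0n0 (D1 t y Jt) (D1 t x0 Jt)) _.
  by rewrite -(WE y t Jt) /W; congr (_ * _); ring.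
exists (d1 t0).
(* If some Wronskian is nonzero, its ratio provides theta; otherwise delta stays
   on a ray, hence is constant, and theta is linear. *)
have [[y0 W0]|W0] := pselect (exists y0, W y0 t0 != 0).
  exists (fun t => (W y0 t0)^-1 * (r y0 t - r y0 t0)).
  have dth t : J t ->
      derive_within J (fun t => (W y0 t0)^-1 * (r y0 t - r y0 t0)) t
        ((delta t x0 ^+ 2)^-1).
    move=> Jt; have := derive_withinZ (c := (W y0 t0)^-1)
      (derive_withinB (dr y0 t Jt) (derive_within_cst J (r y0 t0) t)).
    by move=> /derive_within_val; apply; rewrite subr0 mulrA mulVf ?mul1r.
  split=> //; first by move=> y; exact: D1.
    by rewrite subrr mulr0.
  move=> t y Jt.
  suff : r y t = r y t0 + W y t0 * ((W y0 t0)^-1 * (r y0 t - r y0 t0)).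
    move=> e; rewrite -/(r y t0) -/(W y t0) [_ * W y t0]mulrC -e /r.
    by rewrite mulrC divfK // gt_eqF ?pos.
  apply: (@derive_within_eq _ J (r y)
    (fun t => r y t0 + W y t0 * ((W y0 t0)^-1 * (r y0 t - r y0 t0)))
    _ t0 t itvJ Jt0 Jt (fun u => @dr y u)).
    move=> u Ju; have := derive_withinD (derive_within_cst J (r y t0) u)
      (derive_withinZ (c := W y t0) (dth u Ju)).
    by move=> /derive_within_val; apply; rewrite add0r.
  by rewrite subrr !mulr0 addr0.
have {}W0 y : W y t0 = 0.
  by apply/eqP/negPn/negP => W1; apply: W0; exists y.
have f0 := pos t0 x0 Jt0.
have const t : J t -> delta t = delta t0.
  move=> Jt.
  have rE y : r y t = r y t0.
    apply: (@derive_within_zero _ J (r y) t0 t itvJ Jt0 Jt) => u Ju.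
    by apply: derive_within_val (dr y u Ju) _; rewrite W0 mul0r.
  have dE : delta t = (delta t x0 / delta t0 x0) *: delta t0.
    apply/funext => y; have := rE y; rewrite /r !fctE /GRing.scale /=.
    move=> /(congr1 (fun z => z * delta t x0)).
    rewrite divfK ?gt_eqF ?pos // => ->; field.
    by rewrite gt_eqF.
  rewrite dE (@S_alpha_scale (delta t0) (delta t x0 / delta t0 x0)) ?scale1r //.
  - exact: SJ.
  - by rewrite divr_gt0 ?pos.
  - by rewrite -dE; exact: SJ.
exists (fun t => (delta t0 x0 ^+ 2)^-1 * (t - t0)); split.
- by move=> y; exact: D1.
- by rewrite subrr mulr0.
- move=> t Jt; rewrite const //.
  have := derive_withinZ (c := (delta t0 x0 ^+ 2)^-1)
    (derive_withinB (derive_within_id J t) (derive_within_cst J t0 t)).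
  by move=> /derive_within_val; apply; rewrite subr0 mulr1.
- move=> t y Jt; rewrite const // -/(W y t0) W0 mulr0 addr0.
  by rewrite mulrC divfK // gt_eqF.
Qed.

End Planarity.

Section Clock.
Variables (R : realType) (n : nat) (M : closedOrientedManifold R n).
Variables (lambda : positiveForm M) (alpha : R).
Hypothesis alpha1 : alpha != 1.
Variables f xi : M -> R.
Hypotheses (Sf : S_alpha lambda alpha f) (sxi : smooth xi).

Local Notation amplitude := (amplitude lambda alpha f xi).
Local Notation log_slope := (log_slope lambda alpha f xi).
Local Notation admissible := (admissible f xi).

Lemma clock_exists : exists2 H : R -> R, H 0 = 0 &
  forall s, admissible s -> is_derive s 1 H (amplitude s ^+ 2).
Proof.
apply: continuous_primitive.
- exact: admissible_open Sf sxi.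
- exact: admissible_interval.
- exact: admissible0 Sf.
move=> s As.
have dA := is_derive_amplitude alpha1 Sf sxi As.
have cA : {for s, continuous amplitude}.
  by apply: differentiable_continuous; apply/derivable1_diffP; have [] := dA.
by apply: cvgM; exact: cA.
Qed.

Variable H : R -> R.
Hypothesis dH : forall s, admissible s -> is_derive s 1 H (amplitude s ^+ 2).

Lemma clock_lt s t : admissible s -> admissible t -> s < t -> H s < H t.
Proof.
move=> As At st; apply: (derive_within_gt0_lt (@admissible_interval _ _ _ f xi) As At st).
  by move=> u Au; exact: is_derive_within (dH Au).
by move=> u Au; rewrite exprn_gt0 // (amplitude_gt0 alpha1 Sf sxi Au).
Qed.

Lemma clock_inj s t : admissible s -> admissible t -> H s = H t -> s = t.
Proof.
move=> As At e; have [st|ts|//] := ltgtP s t.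
  by have := clock_lt As At st; rewrite e ltxx.
by have := clock_lt At As ts; rewrite e ltxx.
Qed.

(** By the chain rule [(H (sigma t))' = A(sigma)^2 sigma' = k]. *)
Lemma clock_affine J (sigma : R -> R) k t0 t : is_interval J -> J t0 -> J t ->
  (forall u, J u -> admissible (sigma u)) ->
  (forall u, J u -> derive_within J sigma u (k / amplitude (sigma u) ^+ 2)) ->
  H (sigma t) = H (sigma t0) + k * (t - t0).
Proof.
move=> itvJ Jt0 Jt adm ds.
apply: (@derive_within_eq _ J (H \o sigma) (fun t => H (sigma t0) + k * (t - t0))
  (fun=> k) t0 t itvJ Jt0 Jt) => [u Ju|u Ju|]; last by rewrite /= subrr mulr0 addr0.
  apply: derive_within_val (derive_within_comp (ds u Ju) (dH (adm u Ju))) _.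
  by rewrite mulrC divfK // expf_neq0 // gt_eqF // (amplitude_gt0 alpha1 Sf sxi (adm u Ju)).
have := derive_withinD (derive_within_cst J (H (sigma t0)) u)
  (derive_withinZ (c := k) (derive_withinB (derive_within_id J u) (derive_within_cst J t0 u))).
by move=> /derive_within_val; apply; rewrite subr0 mulr1 add0r.
Qed.

Hypothesis H0 : H 0 = 0.

Lemma clock_ode_solution J sigma t : ode_solution lambda alpha f xi J sigma ->
  J t -> admissible (sigma t) /\ H (sigma t) = t.
Proof.
move=> [[itvJ _] J0 adm [s1 [s2 [d1 d2 e s0 s10]]]] Jt; split; first exact: adm.
have sE u : J u -> s1 u = 1 / amplitude (sigma u) ^+ 2.
  move=> Ju; have := speed_amplitude alpha1 Sf sxi adm d1 d2 e itvJ J0 Ju.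
  rewrite s0 s10 (amplitude0 alpha1 Sf sxi) expr1n mulr1 => <-.
  by rewrite mulfK // expf_neq0 // gt_eqF // (amplitude_gt0 alpha1 Sf sxi (adm u Ju)).
rewrite (@clock_affine J sigma 1 0 t itvJ J0 Jt adm); last first.
  by move=> u Ju; rewrite -sE //; exact: d1.
by rewrite s0 H0 add0r mul1r subr0.
Qed.

(** The inverse of the clock is a solution, and [clock_ode_solution] confines
    every other solution to it. *)
Lemma maximal_solution : admissible 1 ->
  exists (I : set R) (tau : R -> R),
    maximal_ode_solution lambda alpha f xi I tau /\
    (I = H @` admissible /\ forall t, I t -> admissible (tau t) /\ H (tau t) = t).
Proof.
move=> A1; pose I := H @` admissible.
have A0 : admissible 0 := @admissible0 _ _ _ _ _ f xi Sf.
have [tau tauP] : exists tau : R -> R, forall t, I t -> admissible (tau t) /\ H (tau t) = t.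
  have : forall t, exists s, I t -> admissible s /\ H s = t.
    move=> t; have [[s As st]|nI] := pselect (I t); first by exists s.
    by exists 0 => /nI.
  by move=> /choice[tau]; exists tau.
have I0 : I 0 by exists 0.
exists I, tau; split; last by [].
have tauH s : admissible s -> tau (H s) = s.
  by move=> As; have [At Ht] := tauP (H s) (ex_intro2 _ _ s As erefl); exact: clock_inj.
have cH s : admissible s -> {for s, continuous H}.
  move=> As; apply: differentiable_continuous; apply/derivable1_diffP.
  by have [] := dH As.
have dtau t : I t -> is_derive t 1 tau ((amplitude (tau t) ^+ 2)^-1).
  move=> It; have [At Ht] := tauP t It; rewrite -[X in is_derive X]Ht.
  have nA : nbhs (tau t) admissible.
    by apply: open_nbhs_nbhs; split => //; exact: admissible_open Sf sxi.
  apply: (@is_derive_inverse R H).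
  - by apply: filterS nA => s As; exact: tauH.
  - by apply: filterS nA => s As; exact: cH.
  - exact: dH.
  - by rewrite expf_neq0 // gt_eqF // (amplitude_gt0 alpha1 Sf sxi At).
split; last first.
  move=> J sigma sol; split=> [t Jt|t Jt]; have [As Hs] := clock_ode_solution sol Jt.
    by exists (sigma t).
  have It : I t by exists (sigma t).
  by have [At Ht] := tauP t It; apply: clock_inj => //; rewrite Hs Ht.
split=> //.
- split; last first.
    by exists 0, (H 1); split=> //; [exists 1|rewrite -H0; exact: clock_lt].
  apply/connected_intervalP; apply: connected_continuous_connected.
    by apply/connected_intervalP; exact: admissible_interval.
  by apply: continuous_in_subspaceT => s; rewrite inE; exact: cH.
- by move=> t /tauP[].
have adm t : I t -> admissible (tau t) by move=> /tauP[].
pose tau1 t := (amplitude (tau t) * amplitude (tau t))^-1.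
have d1 t : I t -> derive_within I tau t (tau1 t).
  by move=> It; apply: is_derive_within; rewrite /tau1 -expr2; exact: dtau.
exists tau1, (fun t => ode_rhs lambda alpha f xi (tau t) (tau1 t)).
have tau0 : tau 0 = 0 by rewrite -[in LHS]H0 tauH.
split=> //; last by rewrite /tau1 tau0 (amplitude0 alpha1 Sf sxi) mulr1 invr1.
move=> t It; have a0 := amplitude_gt0 alpha1 Sf sxi (adm t It).
have da := derive_within_amplitude alpha1 Sf sxi adm d1 It.
have aa0 : amplitude (tau t) * amplitude (tau t) != 0 by rewrite mulf_neq0 // gt_eqF.
have := @derive_withinV _ I (fun t => amplitude (tau t) * amplitude (tau t)) t _
  aa0 (derive_withinM da da).
move=> /derive_within_val; apply.
rewrite (ode_rhsE lambda alpha1) /tau1.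
by field; rewrite gt_eqF.
Qed.

End Clock.

(** * Uniqueness and the theorem *)

Section Uniqueness.
Variables (R : realType) (n : nat) (M : closedOrientedManifold R n).
Variables (lambda : positiveForm M) (alpha : R).
Hypothesis alpha1 : alpha != 1.
Variable f : M -> R.
Hypothesis Sf : S_alpha lambda alpha f.

(** Pair with [f^(p-1)]: the tangent vector [xi] contributes nothing, [f]
    contributes a positive number. *)
Lemma TS_alpha_coef_gt0 xi a b : TS_alpha lambda alpha f xi ->
  (forall x, 0 < a * f x + b * xi x) -> 0 < a.
Proof.
move=> [sxi]; rewrite exponent_pred // => Ixi pos.
have [sf f0 _] := Sf; have /andP[mu0 mufin] := S_alpha_measure alpha1 Sf.
set q := 2 / (1 - alpha) - 1 in Ixi.
have cT := @manifold_compact _ _ M.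
have cf := smooth_continuous sf; have cxi := smooth_continuous sxi.
have : 0 < integralM lambda (fun x => f x `^ q * (a * f x + b * xi x)).
  apply: Rintegral_gt0 => //; last by move=> x; rewrite mulr_gt0 // powR_gt0.
  apply: continuous_powRM => // x.
  by apply: cvgD; apply: cvgM; [exact: cvg_cst|exact: cf|exact: cvg_cst|exact: cxi].
have -> : integralM lambda (fun x => f x `^ q * (a * f x + b * xi x)) =
    a * integralM lambda (fun x => f x `^ q * (1 * f x))
    + b * integralM lambda (fun x => f x `^ q * xi x).
  rewrite /integralM -Rintegral_lin //.
  - by apply: eq_Rintegral => x _; ring.
  - by apply: continuous_powRM => // x; apply: cvgM; [exact: cvg_cst|exact: cf].
  - exact: continuous_powRM.
rewrite Ixi mulr0 addr0 (integral_radial alpha1 _ Sf) mul1r pmulr_lgt0 //.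
by rewrite powR_gt0 // radius_gt0.
Qed.

(** The planar form of [delta] is [a f + b xi].  Its coefficient [a] is positive
    by [TS_alpha_coef_gt0], and [sigma = b / a] satisfies
    [sigma' a^2 = 1] since the Wronskian of [a] and [b] is 1 at time 0. *)
Lemma geodesic_initial_unique xi I tau J delta :
  ode_solution lambda alpha f xi I tau -> TS_alpha lambda alpha f xi ->
  nondegenerate_interval J -> J 0 -> geodesic lambda alpha J delta ->
  delta 0 = f -> has_velocity J delta 0 xi ->
  forall t, I t -> J t -> delta t = normalized_line lambda alpha f xi tau t.
Proof.
move=> sol Txi ndJ J0 geo d0 vel t It Jt; have [sxi _] := Txi.
have [_ SJ _] := geo; pose x0 : M := point.
have [v [theta [dv th0 dth]]] := geodesic_planar alpha1 x0 ndJ J0 geo.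
have vE y : v y = xi y.
  exact: (derive_within_unique ndJ J0 (dv y) (has_velocity_pointwise (x := y) vel)).
rewrite d0 => dE.
have [_ fpos _] := Sf; have f0 := fpos x0.
pose D u := (f x0)^-1 - xi x0 * theta u.
pose a u := delta u x0 * D u.
pose sigma u := f x0 * theta u / D u.
have dab u y : J u -> delta u y = a u * f y + (delta u x0 * (f x0 * theta u)) * xi y.
  by move=> Ju; rewrite dE // !vE /a /D; ring.
have a0 u : J u -> 0 < a u.
  move=> Ju; apply: (TS_alpha_coef_gt0 (b := delta u x0 * (f x0 * theta u)) Txi) => y.
  by rewrite -dab //; have [_ + _] := SJ u Ju; apply.
have u0 u : J u -> 0 < delta u x0 by move=> /SJ[_ + _]; apply.
have D0 u : J u -> 0 < D u by move=> Ju; have := a0 u Ju; rewrite pmulr_rgt0 // u0.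
have dS u : J u -> delta u = a u *: (f + sigma u *: xi).
  move=> Ju; apply/funext => y; rewrite dab // !fctE /GRing.scale /= /a /sigma.
  by field; rewrite gt_eqF ?D0.
have adm u : J u -> admissible f xi (sigma u).
  move=> Ju y; have [_ + _] := SJ u Ju => /(_ y).
  by rewrite dS // !fctE /GRing.scale /= pmulr_rgt0 // a0.
have aE u : J u -> a u = amplitude lambda alpha f xi (sigma u).
  move=> Ju; apply: (amplitude_unique alpha1 Sf sxi (a0 u Ju) (adm u Ju)).
  by rewrite -(dS u Ju); exact: SJ.
have ds u : J u ->
    derive_within J sigma u (1 / amplitude lambda alpha f xi (sigma u) ^+ 2).
  move=> Ju; have Dn0 : D u != 0 by rewrite gt_eqF ?D0.
  have dD := derive_withinB (derive_within_cst J (f x0)^-1 u)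
               (derive_withinZ (c := xi x0) (dth u Ju)).
  have := derive_within_div Dn0 (derive_withinZ (c := f x0) (dth u Ju)) dD.
  move=> /derive_within_val; apply; rewrite -aE // /a /D; field.
  have fD : 1 + - (xi x0 * theta u) * f x0 = D u * f x0.
    by rewrite /D; field; rewrite gt_eqF.
  by rewrite fD mulf_eq0 negb_or Dn0 (gt_eqF f0) (gt_eqF (u0 u Ju)).
have [H H0 dH] := clock_exists alpha1 Sf sxi.
have [At Ht] := clock_ode_solution alpha1 Sf sxi dH H0 sol It.
have [itvJ _] := ndJ.
have s0 : sigma 0 = 0 by rewrite /sigma th0 mulr0 mul0r.
have Hs : H (sigma t) = t.
  by rewrite (clock_affine alpha1 Sf sxi dH itvJ J0 Jt adm ds) s0 H0 add0r mul1r subr0.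
have e : sigma t = tau t.
  by apply: (clock_inj alpha1 Sf sxi dH) => //; [exact: adm|rewrite Hs Ht].
by rewrite normalized_lineE -e -aE // dS.
Qed.

(** The value at [b] expresses the initial velocity through the endpoints, so
    the planar form becomes
    [delta t = delta t x0 ((1 - rho) f / f(x0) + rho fbar / fbar(x0))] with
    [rho = theta t / theta b] increasing from 0 to 1.  Rescaling gives
    [m (f + sigma (fbar - f))] with [m > 0] and [sigma' m^2] equal to the
    constant [k]. *)
Lemma geodesic_endpoints_unique fbar I tau H T a b delta :
  S_alpha lambda alpha fbar -> let xi := fbar - f in
  (forall s, admissible f xi s -> is_derive s 1 H (amplitude lambda alpha f xi s ^+ 2)) ->
  H 0 = 0 -> is_interval I -> I 0 -> I T ->
  (forall t, I t -> admissible f xi (tau t) /\ H (tau t) = t) -> tau T = 1 ->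
  a < b -> geodesic lambda alpha `[a, b] delta -> delta a = f -> delta b = fbar ->
  forall t, a <= t <= b ->
    delta t = normalized_line lambda alpha f xi tau (T * ((t - a) / (b - a))).
Proof.
move=> Sfb xi dH H0 itvI I0 IT tauP tauT ab geo da db t atb.
have [sf fpos _] := Sf; have [sfb fbpos _] := Sfb.
have sxi : smooth xi.
  have -> : xi = 1 *: fbar + (-1) *: f by rewrite scale1r scaleN1r.
  exact: smooth_lin.
pose J := `[a, b]%classic : set R.
have Ja : J a by rewrite /J /= in_itv /= lexx ltW.
have Jb : J b by rewrite /J /= in_itv /= lexx ltW.
have Jt : J t by rewrite /J /= in_itv.
have itvJ : is_interval J by exact: interval_is_interval.
have ndJ : nondegenerate_interval J by split=> //; exists a, b.
have [_ SJ _] := geo; pose x0 : M := point.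
have [v [theta [_ tha dth]]] := geodesic_planar alpha1 x0 ndJ Ja geo.
rewrite da => dE.
have f0 := fpos x0; have fb0 := fbpos x0.
have u0 u : J u -> 0 < delta u x0 by move=> /SJ[_ + _]; apply.
have thlt s u : J s -> J u -> s < u -> theta s < theta u.
  move=> Js Ju su; apply: (derive_within_gt0_lt itvJ Js Ju su dth) => w Jw.
  by rewrite invr_gt0 exprn_gt0 ?u0.
have thb : 0 < theta b by rewrite -tha; exact: thlt.
pose rho u := theta u / theta b.
have rho01 u : J u -> 0 <= rho u <= 1.
  move=> Ju; rewrite divr_ge0 ?ler_pdivrMr ?mul1r ?(ltW thb) //=; last first.
    have : a <= u by move: Ju; rewrite /J /= in_itv /= => /andP[].
    by rewrite le_eqVlt -tha => /predU1P[->//|au]; apply: ltW; exact: thlt.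
  have : u <= b by move: Ju; rewrite /J /= in_itv /= => /andP[].
  by rewrite le_eqVlt => /predU1P[->//|ub]; apply: ltW; exact: thlt.
pose D u := (1 - rho u) / f x0 + rho u / fbar x0.
have D0 u : J u -> 0 < D u.
  move=> /rho01/andP[r0 r1]; rewrite /D.
  have [r1'|r1'] := ltP (rho u) 1.
    by rewrite ltr_pwDl ?divr_gt0 ?subr_gt0 // divr_ge0 // ltW.
  have -> : rho u = 1 by apply/eqP; rewrite eq_le r1 r1'.
  by rewrite subrr mul0r add0r divr_gt0.
have wE y : f x0 * v y - v x0 * f y = (fbar y / fbar x0 - f y / f x0) / theta b.
  have := dE b y Jb; rewrite db => ->.
  by field; rewrite (gt_eqF thb) (gt_eqF fb0) (gt_eqF f0).
pose m u := delta u x0 * D u.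
pose sigma u := rho u / fbar x0 / D u.
have dS u : J u -> delta u = m u *: (f + sigma u *: xi).
  move=> Ju; apply/funext => y; rewrite dE // wE !fctE /GRing.scale /= /m /sigma.
  have Dn0 : D u != 0 by rewrite gt_eqF ?D0.
  rewrite -[delta u x0 * D u * _]mulrA; congr (_ * _).
  have -> : D u * (f y + rho u / fbar x0 / D u * (fbar y - f y))
          = D u * f y + rho u / fbar x0 * (fbar y - f y).
    by field; rewrite (gt_eqF fb0).
  rewrite /D /rho.
  by field; rewrite (gt_eqF thb) (gt_eqF fb0) (gt_eqF f0).
have m0 u : J u -> 0 < m u by move=> Ju; rewrite mulr_gt0 ?u0 ?D0.
have adm u : J u -> admissible f xi (sigma u).
  move=> Ju y; have [_ + _] := SJ u Ju => /(_ y).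
  by rewrite dS // !fctE /GRing.scale /= pmulr_rgt0 // m0.
have mE u : J u -> m u = amplitude lambda alpha f xi (sigma u).
  move=> Ju; apply: (amplitude_unique alpha1 Sf sxi (m0 u Ju) (adm u Ju)).
  by rewrite -(dS u Ju); exact: SJ.
(* the value of sigma' m^2 *)
pose k := (theta b * f x0 * fbar x0)^-1.
have ds u : J u ->
    derive_within J sigma u (k / amplitude lambda alpha f xi (sigma u) ^+ 2).
  move=> Ju; have Dn0 : D u != 0 by rewrite gt_eqF ?D0.
  have drho : derive_within J rho u ((theta b)^-1 * (delta u x0 ^+ 2)^-1).
    have := derive_withinZ (c := (theta b)^-1) (dth u Ju).
    by under eq_fun do rewrite mulrC.
  have dD := derive_withinD
    (derive_withinZ (c := (f x0)^-1)
      (derive_withinB (derive_within_cst J 1 u) drho))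
    (derive_withinZ (c := (fbar x0)^-1) drho).
  have DE w : D w = (f x0)^-1 * (1 - rho w) + (fbar x0)^-1 * rho w.
    by rewrite /D mulrC [X in _ + X]mulrC.
  have sE : sigma = fun w => (fbar x0)^-1 * rho w
      / ((f x0)^-1 * (1 - rho w) + (fbar x0)^-1 * rho w).
    by apply/funext => w; rewrite -DE /sigma [rho w / _]mulrC.
  rewrite sE; have := derive_within_div _ (derive_withinZ (c := (fbar x0)^-1) drho) dD.
  rewrite -DE => /(_ Dn0) /derive_within_val; apply.
  have -> : (fbar x0)^-1 * rho u / D u = sigma u by rewrite /sigma [rho u / _]mulrC.
  rewrite -mE // /m /k.
  set N := (X in X / _ = _).
  have -> : N = (theta b * f x0 * fbar x0)^-1 * (delta u x0 ^+ 2)^-1.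
    rewrite /N DE; field.
    by rewrite (gt_eqF thb) (gt_eqF fb0) (gt_eqF f0) (gt_eqF (u0 u Ju)).
  by field; rewrite (gt_eqF thb) (gt_eqF fb0) (gt_eqF f0) (gt_eqF (u0 u Ju)) Dn0.
have s_a : sigma a = 0 by rewrite /sigma /rho tha !mul0r.
have s_b : sigma b = 1.
  rewrite /sigma /D /rho divff ?gt_eqF // subrr mul0r add0r !mul1r divff //.
  by rewrite invr_eq0 gt_eqF.
have HE u : J u -> H (sigma u) = k * (u - a).
  by move=> Ju; rewrite (clock_affine alpha1 Sf sxi dH itvJ Ja Ju adm ds) s_a H0 add0r.
have HT : T = k * (b - a).
  by rewrite -HE // s_b -tauT; have [_ ->] := tauP T IT.
have T0 : 0 < T by rewrite HT mulr_gt0 ?subr_gt0 // invr_gt0 !mulr_gt0.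
set t' := T * _.
have Ht' : H (sigma t) = t'.
  by rewrite HE // /t' HT; field; rewrite subr_eq0 gt_eqF.
have It' : I t'.
  apply: (itvI _ _ I0 IT); case/andP: atb => at_ tb.
  rewrite /t' mulr_ge0 ?divr_ge0 ?subr_ge0 ?(ltW T0) ?(ltW ab) //=.
  by rewrite ger_pMr // ler_pdivrMr ?subr_gt0 // mul1r lerD2r.
have [At' Htau] := tauP t' It'.
have e : sigma t = tau t'.
  by apply: (clock_inj alpha1 Sf sxi dH) => //; [exact: adm|rewrite Ht' Htau].
by rewrite normalized_lineE -e -mE // dS.
Qed.

End Uniqueness.

Theorem theorem4p9 (R : realType) (n : nat) (M : closedOrientedManifold R n)
    (lambda : positiveForm M) (alpha : R) (halpha : alpha != 1)
    (f : M -> R) (hf : S_alpha lambda alpha f) :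
  (forall (xi : M -> R) (I : set R) (tau : R -> R),
     smooth xi -> xi <> f -> ode_solution lambda alpha f xi I tau ->
     let gamma := normalized_line lambda alpha f xi tau in
     [/\ geodesic lambda alpha I gamma,
         gamma 0 = f &
         TS_alpha lambda alpha f xi ->
           has_velocity I gamma 0 xi /\
           forall (J : set R) (delta : R -> M -> R),
             nondegenerate_interval J -> J 0 ->
             geodesic lambda alpha J delta ->
             delta 0 = f -> has_velocity J delta 0 xi ->
             forall t, I t -> J t -> delta t = gamma t]) /\
  (forall fbar : M -> R, S_alpha lambda alpha fbar ->
     exists (I : set R) (tau : R -> R),
       maximal_ode_solution lambda alpha f (fbar - f) I tau /\
       let gamma := normalized_line lambda alpha f (fbar - f) tau in
       exists T : R,
         [/\ 0 < T, I T, tau T = 1,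
             [/\ geodesic lambda alpha `[0, T] gamma,
                 gamma 0 = f & gamma T = fbar] &
             forall (a b : R) (delta : R -> M -> R), a < b ->
               geodesic lambda alpha `[a, b] delta ->
               delta a = f -> delta b = fbar ->
               forall t, a <= t <= b ->
                 delta t = gamma (T * ((t - a) / (b - a)))]).
Proof.
split=> [xi I tau sxi _ sol gamma|fbar Sfb].
  have [[itvI _] I0 adm [tau1 [tau2 [d1 d2 ode tau0 tau10]]]] := sol.
  have gamma0 : gamma 0 = f.
    by rewrite /gamma normalized_lineE tau0 amplitude0 // scale0r addr0 scale1r.
  split; [|exact: gamma0|].
    exact: (normalized_line_geodesic halpha hf sxi adm d1 d2 ode).
  move=> Txi; split; last first.
    move=> J delta ndJ J0 geo e0 vel; exact: geodesic_initial_unique.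
  have [sf _ _] := hf.
  have da := derive_within_amplitude halpha hf sxi adm d1 I0.
  have := has_velocity_lin sf sxi da (derive_withinM (d1 0 I0) da).
  rewrite tau0 tau10 amplitude0 // mul0r addr0 !mul1r scale1r.
  have -> : log_slope lambda alpha f xi 0 = 0.
    rewrite /log_slope; have [_] := Txi; rewrite exponent_pred // => Ixi.
    have -> : moment lambda f xi (2 / (1 - alpha) - 1) xi 0 = 0.
      by rewrite -[RHS]Ixi; apply: eq_Rintegral => x _; rewrite mul0r addr0.
    by rewrite mul0r.
  rewrite oppr0 mul0r scale0r add0r.
  have -> // : (fun u => amplitude lambda alpha f xi (tau u) *: f +
    (tau u * amplitude lambda alpha f xi (tau u)) *: xi) = gamma.
  apply/funext => u; rewrite /gamma normalized_lineE scalerDr scalerA.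
  by rewrite [tau u * _]mulrC.
pose xi := fbar - f.
have [sf fpos If] := hf; have [sfb fbpos _] := Sfb.
have sxi : smooth xi.
  have -> : xi = 1 *: fbar + (-1) *: f by rewrite scale1r scaleN1r.
  exact: smooth_lin.
have A1 : admissible f xi 1 by move=> x; rewrite mul1r /xi !fctE subrKC.
have A0 : admissible f xi 0 := admissible0 xi hf.
have [H H0 dH] := clock_exists halpha hf sxi.
have [I [tau [mx [IE tauP]]]] := maximal_solution halpha hf sxi dH H0 A1.
exists I, tau; split=> // gamma.
have [sol _] := mx; have [[itvI _] I0 adm [tau1 [tau2 [d1 d2 ode tau0 tau10]]]] := sol.
have T0 : 0 < H 1 by rewrite -H0; exact: (clock_lt halpha hf sxi dH).
have IT : I (H 1) by rewrite IE; exists 1.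
have tauT : tau (H 1) = 1.
  by have [At Ht] := tauP _ IT; exact: (clock_inj halpha hf sxi dH).
have gammaT : gamma (H 1) = fbar.
  have fE : f + 1 *: xi = fbar by rewrite scale1r /xi subrKC.
  rewrite /gamma normalized_lineE tauT -/xi fE.
  have S1 : S_alpha lambda alpha (1 *: (f + 1 *: xi)) by rewrite fE scale1r.
  by rewrite -(amplitude_unique halpha hf sxi ltr01 A1 S1) scale1r.
have gamma0 : gamma 0 = f.
  by rewrite /gamma normalized_lineE tau0 amplitude0 // scale0r addr0 scale1r.
exists (H 1); split; [exact: T0|exact: IT|exact: tauT| |].
- split; [|exact: gamma0|exact: gammaT].
  have sub := is_interval_itvcc itvI I0 IT.
  have ndT : nondegenerate_interval `[0, H 1].
    split; first exact: interval_is_interval.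
    by exists 0, (H 1); rewrite /= !in_itv /= !lexx (ltW T0).
  have T0' : `[0, H 1]%classic 0 by rewrite /= in_itv /= lexx ltW.
  have [_ _ admT [s1 [s2 [e1 e2 odeT _ _]]]] := ode_solution_sub sol sub ndT T0'.
  exact: (normalized_line_geodesic halpha hf sxi admT e1 e2 odeT).
- move=> a b delta ab geo da db.
  exact: (geodesic_endpoints_unique halpha hf Sfb dH H0 itvI I0 IT).
Qed.
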